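(* Let $\Gamma$ be a finite simplicial graph with vertex set $V=\{v_1,\dots,v_n\}$ and let $A_\Gamma$ be the associated right-angled Artin group. The palindromic automorphism group $\Pi\mathrm{A}_\Gamma$ is generated by the finite set consisting of all diagram automorphisms of $A_\Gamma$, all inversions $\iota_j$ ($1\le j\le n$), and all well-defined automorphisms $P_{ij}$ ($i\neq j$).
   Context: $A_\Gamma$ is the group with generating set $V$ and relations $[v_i,v_j]=1$ whenever $v_i,v_j$ are joined by an edge of $\Gamma$. An automorphism $\alpha\in\mathrm{Aut}(A_\Gamma)$ is palindromic if for each $v\in V$ the element $\alpha(v)$ can be expressed as a word $u_1\cdots u_k$ on $V^{\pm1}$ that is identical, as a word, to its reverse $u_k\cdots u_1$. $\Pi\mathrm{A}_\Gamma$ denotes the set of all palindromic automorphisms of $A_\Gamma$; it is a subgroup of $\mathrm{Aut}(A_\Gamma)$. A diagram automorphism is an automorphism of $A_\Gamma$ induced by a graph automorphism $\phi\in\mathrm{Aut}(\Gamma)$ via $v\mapsto\phi(v)$. The inversion $\iota_j$ maps $v_j$ to $v_j^{-1}$ and fixes every $v_k$ with $k\ne j$. $P_{ij}$ denotes the map sending $v_i$ to $v_jv_iv_j$ and fixing every $v_k$ with $k\neq i$; ''well-defined'' means that this map on $V$ induces an automorphism of $A_\Gamma$ (this is the case when every vertex adjacent to $v_i$ is equal or adjacent to $v_j$). *)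

(* Defs.v *)
From HB Require Import structures.
From mathcomp Require Import all_boot perm.
From mathcomp Require Import boolp classical_sets cardinality.

Set Implicit Arguments.
Unset Strict Implicit.
Unset Printing Implicit Defensive.

Local Open Scope quotient_scope.
Local Open Scope group_scope.
Local Open Scope classical_set_scope.

Section Aut.
Variable G : groupType.

Definition automorphism (f : G -> G) : Prop :=
  bijective f /\ {morph f : x y / x * y}.

(* [fingroup.automorphism.Aut] only covers finite groups. *)
Record autom := Autom { aut_fun :> G -> G; _ : `[< automorphism aut_fun >] }.

HB.instance Definition _ := [isSub for aut_fun].
HB.instance Definition _ := [Choice of autom by <:].

Lemma autP (a : autom) : automorphism a.
Proof. by case: a => f fP; apply/asboolP. Qed.

Lemma autom_ext (a b : autom) : a =1 b -> a = b.
Proof. by move=> ab; apply/val_inj/funext. Qed.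

Lemma aut_id_subproof : automorphism idfun.
Proof. by split=> //; exists idfun. Qed.

Lemma aut_comp_subproof (a b : autom) : automorphism (a \o b).
Proof.
have [[aB aM] [bB bM]] := (autP a, autP b).
by split=> [|x y /=]; [exact: bij_comp | rewrite bM aM].
Qed.

Lemma aut_inv_subproof (a : autom) :
  {g : G -> G | [/\ automorphism g, cancel a g & cancel g a]}.
Proof.
apply: cid; have [[g ag ga] aM] := autP a; exists g; split=> //.
split; first by exists a.
by move=> x y; apply: (can_inj ag); rewrite aM !ga.
Qed.

Definition aut_id : autom := Autom (asboolT aut_id_subproof).

(* (a * b) x = a (b x) *)
Definition aut_comp (a b : autom) : autom := Autom (asboolT (aut_comp_subproof a b)).

Lemma aut_inv_aut (a : autom) : automorphism (sval (aut_inv_subproof a)).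
Proof. by case: aut_inv_subproof => g []. Qed.

Definition aut_inv (a : autom) : autom := Autom (asboolT (aut_inv_aut a)).

Lemma autK (a : autom) : cancel a (aut_inv a).
Proof. by rewrite /aut_inv /=; case: aut_inv_subproof => g []. Qed.

Lemma autVK (a : autom) : cancel (aut_inv a) a.
Proof. by rewrite /aut_inv /=; case: aut_inv_subproof => g []. Qed.

Lemma aut_compA : associative aut_comp.
Proof. by move=> a b c; apply: autom_ext. Qed.

Lemma aut_comp1l : left_id aut_id aut_comp.
Proof. by move=> a; apply: autom_ext. Qed.

Lemma aut_comp1r : right_id aut_id aut_comp.
Proof. by move=> a; apply: autom_ext. Qed.

Lemma aut_compVl : left_inverse aut_id aut_inv aut_comp.
Proof. by move=> a; apply: autom_ext => x; exact: autK. Qed.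

Lemma aut_compVr : right_inverse aut_id aut_inv aut_comp.
Proof. by move=> a; apply: autom_ext => x; exact: autVK. Qed.

HB.instance Definition _ := isGroup.Build autom
  aut_compA aut_comp1l aut_comp1r aut_compVl aut_compVr.

End Aut.

Definition subgroup (G : groupType) (H : set G) : Prop :=
  [/\ H 1, forall x y, H x -> H y -> H (x * y) & forall x, H x -> H x^-1].

Definition generated_subgroup (G : groupType) (S : set G) : set G :=
  smallest (@subgroup G) S.

Section RAAG.
Variables (V : finType) (e : rel V).

(* Words on V^{+1, -1}: (v, true) stands for v and (v, false) for v^-1. *)
Definition word := seq (V * bool).

Definition inv_letter (x : V * bool) : V * bool := (x.1, ~~ x.2).
Definition inv_word (w : word) : word := rev (map inv_letter w).

(* The congruence presenting < V | [v, w] = 1 whenever e v w >. *)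
Inductive word_eqv : word -> word -> Prop :=
| WRefl u : word_eqv u u
| WSym u v : word_eqv u v -> word_eqv v u
| WTrans v u w : word_eqv u v -> word_eqv v w -> word_eqv u w
| WCat u u' v v' : word_eqv u u' -> word_eqv v v' -> word_eqv (u ++ v) (u' ++ v')
| WCancel x : word_eqv [:: x; inv_letter x] [::]
| WComm v w : e v w ->
    word_eqv [:: (v, true); (w, true); (v, false); (w, false)] [::].

Definition word_eqb : rel word := fun u v => `[< word_eqv u v >].

Lemma word_eqb_refl : reflexive word_eqb.
Proof. by move=> u; apply/asboolP; exact: WRefl. Qed.

Lemma word_eqb_sym : symmetric word_eqb.
Proof. by move=> u v; apply: asbool_equiv_eq; split; exact: WSym. Qed.

Lemma word_eqb_trans : transitive word_eqb.
Proof. by move=> v u w /asboolP uv /asboolP vw; apply/asboolP; exact: WTrans vw. Qed.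

Canonical word_equiv := EquivRel word_eqb word_eqb_refl word_eqb_sym word_eqb_trans.

Definition raag := {eq_quot word_equiv}.
HB.instance Definition _ := Choice.on raag.
HB.instance Definition _ := EqQuotient.on raag.

Definition word_elt (w : word) : raag := \pi_raag w.

Lemma word_eltP u v : word_elt u = word_elt v <-> word_eqv u v.
Proof.
split=> [/eqP|uv]; first by rewrite piE => /asboolP.
by apply/eqP; rewrite piE; apply/asboolP.
Qed.

Definition raag_one : raag := word_elt [::].
Definition raag_mul (x y : raag) : raag := word_elt (repr x ++ repr y).
Definition raag_inv (x : raag) : raag := word_elt (inv_word (repr x)).

Lemma word_eltK (x : raag) : word_elt (repr x) = x.
Proof. exact: reprK. Qed.

Lemma repr_eqv u : word_eqv (repr (word_elt u)) u.
Proof. by apply/word_eltP; rewrite word_eltK. Qed.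

Lemma raag_mulE u v : raag_mul (word_elt u) (word_elt v) = word_elt (u ++ v).
Proof. by apply/word_eltP; apply: WCat; exact: repr_eqv. Qed.

Lemma inv_letterK : involutive inv_letter.
Proof. by case=> v b; rewrite /inv_letter /= negbK. Qed.

Lemma inv_wordK : involutive inv_word.
Proof.
move=> w; rewrite /inv_word map_rev revK -map_comp.
by rewrite (eq_map inv_letterK) map_id.
Qed.

Lemma word_eqv_mulV w : word_eqv (w ++ inv_word w) [::].
Proof.
elim: w => [|x w IHw]; first exact: WRefl.
rewrite /inv_word /= rev_cons -cats1 catA -cat1s.
have IH2 : word_eqv ((w ++ inv_word w) ++ [:: inv_letter x]) [:: inv_letter x].
  by rewrite -[X in word_eqv _ X]cat0s; apply: WCat => //; exact: WRefl.
by apply: WTrans (WCancel x); rewrite -[X in word_eqv _ X]cat1s;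
  apply: WCat => //; exact: WRefl.
Qed.

Lemma raag_mulA : associative raag_mul.
Proof.
move=> x y z; rewrite -(word_eltK x) -(word_eltK y) -(word_eltK z).
by rewrite !raag_mulE catA.
Qed.

Lemma raag_mul1l : left_id raag_one raag_mul.
Proof. by move=> x; rewrite -(word_eltK x) raag_mulE. Qed.

Lemma raag_mul1r : right_id raag_one raag_mul.
Proof. by move=> x; rewrite -(word_eltK x) raag_mulE cats0. Qed.

Lemma raag_mulVr : right_inverse raag_one raag_inv raag_mul.
Proof.
move=> x; rewrite -{1}(word_eltK x) raag_mulE.
by apply/word_eltP; exact: word_eqv_mulV.
Qed.

Lemma raag_mulVl : left_inverse raag_one raag_inv raag_mul.
Proof.
move=> x; rewrite -{2}(word_eltK x) raag_mulE.
by apply/word_eltP; rewrite -{2}(inv_wordK (repr x)); exact: word_eqv_mulV.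
Qed.

HB.instance Definition _ := isGroup.Build raag
  raag_mulA raag_mul1l raag_mul1r raag_mulVl raag_mulVr.

Definition raag_gen (v : V) : raag := word_elt [:: (v, true)].

(* [rev] reverses the order of the letters and keeps their exponents. *)
Definition palindromic (a : autom raag) : Prop :=
  forall v : V, exists w : word, rev w = w /\ a (raag_gen v) = word_elt w.

Definition graph_aut (phi : {perm V}) : Prop :=
  forall v w, e (phi v) (phi w) = e v w.

Definition diagram_aut (a : autom raag) : Prop :=
  exists phi : {perm V},
    graph_aut phi /\ forall v, a (raag_gen v) = raag_gen (phi v).

Definition is_inversion (j : V) (a : autom raag) : Prop :=
  a (raag_gen j) = (raag_gen j)^-1 /\
  forall k, k != j -> a (raag_gen k) = raag_gen k.

(* P_ij counts as well defined exactly when such an automorphism [a] exists;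
   it is then unique, since the [raag_gen v] generate. *)
Definition is_P (i j : V) (a : autom raag) : Prop :=
  a (raag_gen i) = raag_gen j * raag_gen i * raag_gen j /\
  forall k, k != i -> a (raag_gen k) = raag_gen k.

Definition palindromic_auts : set (autom raag) := [set a | palindromic a].

Definition palindromic_gens : set (autom raag) :=
  [set a | diagram_aut a
        \/ (exists j, is_inversion j a)
        \/ (exists i j, i != j /\ is_P i j a)].

End RAAG.

Arguments palindromic_auts {V} e.
Arguments palindromic_gens {V} e.

(* Main.v *)
Require Import Defs.
From mathcomp Require Import all_boot perm.
From mathcomp Require Import boolp classical_sets cardinality.
From mathcomp Require fingroup.
From mathcomp Require Import zify.

(** Write [occ w g] for the number of letters [w] or [w^-1] in a reduced word for
    [g], and call [g] symmetric when the automorphism inverting all generators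
    sends [g] to [g^-1].  Palindromes are symmetric, so a palindromic automorphism
    and its inverse preserve symmetric elements.

    Symmetric elements behave like translations of a line: the first and the last
    [w] in a reduced word for [g] carry the same sign, so the letter [w] cannot be
    cancelled both in [g * h] and in [g * h^-1] ([occ_dichotomy]).  Hence
    [occ w (g ^+ n)] is [n * occ w g], and for commuting [p] and [q] the letter [w]
    disappears from [r], a product of the powers of [p] and [q] with exponents
    [occ w q] and, up to sign, [occ w p].  If [w] occurs in [p], then counting the
    letters in front of the first [w] on both sides of [r^n * p = p * r^n] shows
    that [w] is adjacent to every letter of [r] ([axis_link]).

    Applied to the images of two adjacent vertices, this has two consequences.
    Modulo squares a palindromic automorphism permutes the generators, and the
    permutation is a graph symmetry ([odd_class_edge]); a diagram automorphism
    removes it and leaves a pure automorphism.  If [a] is pure and [w] occurs in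
    [a v], then every neighbour of [v] is equal or adjacent to [w] ([pure_dom]):
    exactly the condition for [P_vw] to exist.

    A pure automorphism is then shortened by composing it with maps [P_ij] and
    their inverses as long as this lowers the letter counts of the images in
    lexicographic order ([descent]).  When no step applies, every generator is
    fixed up to sign, so that the automorphism is a product of inversions.  This is
    proved by induction along the domination preorder.  If the vertices strictly
    above [v] are fixed up to sign, the image of [v] can only begin with letters
    equivalent to [v], since others could be stripped ([no_initial]).  Two
    cases remain.  If two vertices equivalent to [v] are adjacent, all vertices
    above [v] form a clique, the images lie in a free abelian group and are
    diagonal by Euclid's algorithm, performed one coordinate after the other in
    the lexicographic order ([clique_diag]).  Otherwise the vertices equivalent to
    [v] are adjacent to no letter in sight, and the argument is Nielsen's, in the
    form that Collins gave it for free groups: the images are palindromes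
    [u y (rev u)] of odd length, and if cancellation between two of them reached
    the middle letter of one, a map [P_ij] would shorten the other
    ([middle_survives]).  So middle letters survive in the image of every reduced
    word; applied to a word for [a^-1 v], whose image is the single letter [v],
    this leaves no room for a nonempty [u]. *)

Set Implicit Arguments.
Unset Strict Implicit.
Unset Printing Implicit Defensive.

Local Open Scope group_scope.
Local Open Scope nat_scope.

Section RaagTheory.
Variables (V : finType) (e : rel V).
Hypotheses (e_sym : symmetric e) (e_irr : irreflexive e).

Local Notation letter := (V * bool)%type.
Local Notation word := (seq (V * bool)).
Local Notation inv := (@inv_letter V).
Local Notation eqv := (word_eqv e).

(** * Reduced words *)

Definition dep (x y : letter) := ~~ e x.1 y.1.

(** [x] can be moved to the front of [w]: it precedes every letter of [w] with
    which it does not commute. *)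
Definition starts (x : letter) (w : word) := ohead (filter (dep x) w) == Some x.

Definition proj (a b : V) (w : word) :=
  [seq x <- w | (x.1 == a) || (x.1 == b)].

(** Equality of traces, that is, equality up to exchanging neighbouring letters on
    adjacent vertices.  Encoding it by the projections to pairs of nonadjacent
    vertices (which include the pairs [(a, a)]) makes it visibly stable under
    concatenation, reversal and cancellation; [teq_eqv] relates it to the group. *)
Definition teq (u v : word) := forall a b, ~~ e a b -> proj a b u = proj a b v.

Definition cnt (a : V) (w : word) := count (fun x : letter => x.1 == a) w.

Fixpoint red (w : word) :=
  if w is x :: w' then ~~ starts (inv x) w' && red w' else true.

(** Left multiplication by a letter, acting on reduced words. *)
Definition push (x : letter) (w : word) :=
  if starts (inv x) w then rem (inv x) w else x :: w.

Lemma invK : involutive inv. Proof. exact: inv_letterK. Qed.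

Lemma inv_neq x : inv x != x.
Proof. by case: x => v [] ; apply/eqP => -[]. Qed.

Lemma same_base (x y : letter) : x.1 = y.1 -> x = y \/ x = inv y.
Proof.
case: x y => [a b] [c d] /= ->; case: (b =P d) => [->|bd]; [by left|right].
by rewrite /inv_letter /=; congr pair; case: b d bd => [] [].
Qed.

Lemma dep_sym x y : dep x y = dep y x. Proof. by rewrite /dep e_sym. Qed.
Lemma depxx x : dep x x. Proof. by rewrite /dep e_irr. Qed.
Lemma depV x y : dep (inv x) y = dep x y. Proof. by []. Qed.

Lemma teq_sym u v : teq u v -> teq v u.
Proof. by move=> uv a b ab; rewrite uv. Qed.
Lemma teq_trans v u w : teq u v -> teq v w -> teq u w.
Proof. by move=> uv vw a b ab; rewrite uv // vw. Qed.
Lemma teq_cat u u' v v' : teq u u' -> teq v v' -> teq (u ++ v) (u' ++ v').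
Proof. by move=> uu vv a b ab; rewrite /proj !filter_cat -!/(proj _ _ _) uu // vv. Qed.
Lemma teq_cons x u v : teq u v -> teq (x :: u) (x :: v).
Proof. exact: (@teq_cat [:: x] [:: x]). Qed.
Lemma teq_rev u v : teq u v -> teq (rev u) (rev v).
Proof. by move=> uv a b ab; rewrite /proj !filter_rev -!/(proj _ _ _) uv. Qed.
Lemma proj_inv a b w : proj a b (map inv w) = map inv (proj a b w).
Proof. by rewrite /proj filter_map. Qed.
Lemma teq_inv u v : teq u v -> teq (map inv u) (map inv v).
Proof. by move=> uv a b ab; rewrite !proj_inv uv. Qed.
Lemma teq_cons_inj x u v : teq (x :: u) (x :: v) -> teq u v.
Proof.
move=> uv a b ab; have := uv a b ab; rewrite /proj /=.
by case: ifP => // _ [].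
Qed.
Lemma teq_catl w u v : teq (w ++ u) (w ++ v) -> teq u v.
Proof. by elim: w => //= x w IH /teq_cons_inj. Qed.
Lemma teq_catr w u v : teq (u ++ w) (v ++ w) -> teq u v.
Proof.
move=> /teq_rev; rewrite !rev_cat => /teq_catl /teq_rev.
by rewrite !revK.
Qed.

Lemma cntE a w : cnt a w = size (proj a a w).
Proof. by rewrite size_filter; apply: eq_count => x; rewrite orbb. Qed.
Lemma teq_cnt a u v : teq u v -> cnt a u = cnt a v.
Proof. by move=> uv; rewrite !cntE uv // e_irr. Qed.
Lemma teq_mem x u v : teq u v -> (x \in u) = (x \in v).
Proof.
have P w : (x \in w) = (x \in proj x.1 x.1 w) by rewrite mem_filter eqxx.
by move=> uv; rewrite P uv -?P // e_irr.
Qed.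
Lemma teq_nil u : teq u [::] -> u = [::].
Proof. by case: u => // x u /(teq_mem x); rewrite inE eqxx. Qed.
Lemma teq_perm u v : teq u v -> perm_eq u v.
Proof.
move=> uv; apply/allP => x _ /=; apply/eqP.
have P w : count_mem x w = count_mem x (proj x.1 x.1 w).
  rewrite count_filter; apply: eq_count => y /=.
  by case: (y =P x) => //= ->; rewrite eqxx.
by rewrite P uv -?P // e_irr.
Qed.
Lemma teq_size u v : teq u v -> size u = size v.
Proof. by move/teq_perm/perm_size. Qed.

Lemma ohead_filter (P Q : pred letter) w y :
  ohead (filter P w) = Some y -> Q y -> subpred Q P ->
  ohead (filter Q w) = Some y.
Proof.
move=> + Qy QP; elim: w => //= z w IH.
case: ifP => [_ [->]|Pz]; first by rewrite Qy.
by case: ifP => // /QP; rewrite Pz.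
Qed.

(** If [y] is the first letter of [v] that does not commute with [x], compare the
    projections to the pair of their vertices: both start with the same letter. *)
Lemma starts_teq x u v : teq u v -> starts x u -> starts x v.
Proof.
move=> uv /eqP su; apply/eqP.
have xu : x \in u.
  have : x \in filter (dep x) u by case: (filter _ u) su => // y s [->]; rewrite inE eqxx.
  by rewrite mem_filter => /andP[].
have : x \in filter (dep x) v by rewrite mem_filter depxx -(teq_mem x uv).
case E: (filter (dep x) v) => [|y s] // _ /=.
have /andP[dxy yv] : dep x y && (y \in v) by rewrite -mem_filter E inE eqxx.
pose Q := [pred z : letter | (z.1 == x.1) || (z.1 == y.1)].
have QP : subpred Q (dep x).
  by move=> z /= /orP[]/eqP zz; rewrite /dep zz // e_irr.
have h1 : ohead (filter Q u) = Some x by apply: ohead_filter su _ QP; rewrite /= eqxx.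
have h2 : ohead (filter Q v) = Some y.
  by apply: (ohead_filter (P := dep x)) QP; rewrite ?E //= eqxx orbT.
by move: h2; rewrite -[filter _ v](uv x.1 y.1 dxy) -/(filter Q u) h1 => -[->].
Qed.

Lemma starts_cons x y w :
  starts x (y :: w) = if dep x y then y == x else starts x w.
Proof. by rewrite /starts /=; case: ifP. Qed.

Lemma starts_mem x w : starts x w -> x \in w.
Proof.
elim: w => // y w IH; rewrite starts_cons inE eq_sym.
by case: ifP => _ H; rewrite ?H // IH // orbT.
Qed.

Lemma starts_cat x u v : starts x u -> starts x (u ++ v).
Proof.
by elim: u => // y u IH /=; rewrite !starts_cons; case: ifP.
Qed.

Lemma starts_rem x w : starts x w -> teq w (x :: rem x w).
Proof.
elim: w => // y w IH; rewrite starts_cons /=.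
case: ifP => [_ /eqP->|dxy sw]; first by rewrite eqxx.
have -> : (y == x) = false by apply: contraFF dxy => /eqP->; exact: depxx.
apply: teq_trans (teq_cons y (IH sw)) _ => a b ab; rewrite /proj /=.
move/negbT: dxy; rewrite negbK => exy.
case: (boolP ((y.1 == a) || _)) => // /orP[]/eqP ya;
case: (boolP ((x.1 == a) || _)) => // /orP[]/eqP xa; move: exy ab;
by rewrite ?ya ?xa ?e_irr // e_sym => ->.
Qed.

Lemma starts_consx x w : starts x (x :: w).
Proof. by rewrite starts_cons depxx eqxx. Qed.

Lemma starts_cons_eqv x w : starts x w -> exists w', teq w (x :: w').
Proof. by move=> /starts_rem; exists (rem x w). Qed.

Lemma eqv_comm (x y : letter) : e x.1 y.1 -> eqv [:: x; y] [:: y; x].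
Proof.
have C (u v : word) : eqv (u ++ v) [::] -> eqv u (inv_word v).
  move=> uv; apply: (@WTrans _ _ (u ++ v ++ inv_word v)).
    rewrite -{1}[u]cats0; apply: WCat; first exact: WRefl.
    by apply: WSym; exact: word_eqv_mulV.
  rewrite catA -[X in eqv _ X]cat0s; apply: WCat => //; exact: WRefl.
have comm u v : eqv (u ++ v ++ inv_word u ++ inv_word v) [::] -> eqv (u ++ v) (v ++ u).
  rewrite catA => /C; rewrite /inv_word map_cat rev_cat -!/(inv_word _).
  by rewrite !inv_wordK.
have swp u v : eqv (u ++ v) (v ++ u) -> eqv (inv_word u ++ v) (v ++ inv_word u).
  move=> uv; apply: (@WTrans _ _ (inv_word u ++ (v ++ u) ++ inv_word u)).
    apply: WCat; first exact: WRefl.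
    rewrite -catA -{1}[v]cats0; apply: WCat; first exact: WRefl.
    by apply: WSym; exact: word_eqv_mulV.
  apply: (@WTrans _ _ (inv_word u ++ (u ++ v) ++ inv_word u)).
    apply: WCat; first exact: WRefl.
    by apply: WCat; [exact: WSym | exact: WRefl].
  rewrite -catA catA -[X in eqv _ X]cat0s; apply: WCat; last exact: WRefl.
  by rewrite -{2}(inv_wordK u); exact: word_eqv_mulV.
case: x y => [a b] [c d] /= eac.
have base : eqv [:: (a, true); (c, true)] [:: (c, true); (a, true)].
  by apply: (comm [:: (a, true)] [:: (c, true)]); exact: WComm.
have h1 : eqv [:: (a, b); (c, true)] [:: (c, true); (a, b)].
  by case: b => //; exact: (swp [:: (a, true)] [:: (c, true)]).
case: d => //; apply: WSym.
by apply: (swp [:: (c, true)] [:: (a, b)]); exact: WSym.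
Qed.

Lemma starts_eqv x w : starts x w -> eqv w (x :: rem x w).
Proof.
elim: w => // y w IH; rewrite starts_cons /=.
case: ifP => [_ /eqP->|dxy sw]; first by rewrite eqxx; exact: WRefl.
have -> : (y == x) = false by apply: contraFF dxy => /eqP->; exact: depxx.
apply: (@WTrans _ _ ([:: y] ++ (x :: rem x w))).
  by rewrite -cat1s; apply: WCat; [exact: WRefl | exact: IH].
apply: (@WCat _ _ [:: y; x] [:: x; y] (rem x w)); last exact: WRefl.
by apply: eqv_comm; rewrite e_sym; move/negbT: dxy; rewrite negbK.
Qed.

Lemma eqv_cons x u v : eqv u v -> eqv (x :: u) (x :: v).
Proof. by move=> uv; apply: (@WCat _ _ [:: x] [:: x]) => //; exact: WRefl. Qed.

(** The first letter of [u] can be moved to the front of [v]; strip it and go on. *)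
Lemma teq_eqv u v : teq u v -> eqv u v.
Proof.
elim: u v => [|x u IH] v uv.
  by rewrite (teq_nil (teq_sym uv)); exact: WRefl.
have sv : starts x v by apply: starts_teq uv _; exact: starts_consx.
apply: WTrans (WSym (starts_eqv sv)); apply: eqv_cons; apply: IH.
by apply: (@teq_cons_inj x); apply: teq_trans uv (starts_rem sv).
Qed.

Lemma filter_dep_rem x y w : ~~ dep x y -> filter (dep x) (rem y w) = filter (dep x) w.
Proof.
move=> dxy; elim: w => //= z w IH; case: (z =P y) => [->|_ /=]; last by rewrite IH.
by rewrite (negbTE dxy).
Qed.

Lemma starts_rem_dep x y w : ~~ dep x y -> starts x (rem y w) = starts x w.
Proof. by move=> xy; rewrite /starts filter_dep_rem. Qed.

Lemma red_rem y w : red w -> starts y w -> red (rem y w) && ~~ starts (inv y) (rem y w).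
Proof.
elim: w => // x w IH /= /andP[sx redw]; rewrite starts_cons.
case: ifP => [_ /eqP E|dyx sw]; first by rewrite E eqxx -E redw sx.
have xy : ~~ dep x y by rewrite dep_sym dyx.
have -> : (x == y) = false by apply: contraFF dyx => /eqP->; exact: depxx.
have /andP[r1 s1] := IH redw sw.
by rewrite /= r1 starts_cons depV dyx s1 starts_rem_dep // sx.
Qed.

Lemma red_teq u v : teq u v -> red u -> red v.
Proof.
elim: v u => // y v IH u uv ru /=.
have su : starts y u by apply: (starts_teq (teq_sym uv)); exact: starts_consx.
have /andP[r1 s1] := red_rem ru su.
have uv' : teq (rem y u) v.
  by apply: (@teq_cons_inj y); apply: teq_trans uv; apply/teq_sym/starts_rem.
rewrite (IH _ uv' r1) andbT; apply: contra s1; exact/starts_teq/teq_sym.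
Qed.

Lemma red_push x w : red w -> red (push x w).
Proof.
rewrite /push; case: ifP => [sw redw|/= -> //].
by have /andP[] := red_rem redw sw.
Qed.

Lemma teq_push x u v : teq u v -> teq (push x u) (push x v).
Proof.
move=> uv; have -> : push x v = if starts (inv x) u then rem (inv x) v else x :: v.
  rewrite /push; congr (if _ then _ else _).
  by apply/idP/idP; apply: starts_teq => //; exact: teq_sym.
rewrite /push; case: ifP => su; last exact: teq_cons.
apply: (@teq_cons_inj (inv x)); apply: teq_trans (starts_rem _).
  by apply: teq_trans uv; apply/teq_sym/starts_rem.
exact: starts_teq uv su.
Qed.

Lemma pushV x w : red w -> teq (push x (push (inv x) w)) w.
Proof.
move=> redw; rewrite {2}/push invK; case: ifP => sw; last first.
  by rewrite /push starts_consx /= eqxx.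
have /andP[_ s1] := red_rem redw sw.
by rewrite /push (negbTE s1); apply/teq_sym/starts_rem.
Qed.

Lemma starts_push x y w : ~~ dep x y -> starts x (push y w) = starts x w.
Proof.
move=> xy; rewrite /push; case: ifP => _; first exact: starts_rem_dep.
by rewrite starts_cons (negbTE xy).
Qed.

Lemma remC (T : eqType) (x y : T) w : rem x (rem y w) = rem y (rem x w).
Proof.
case: (x =P y) => [->//|/eqP xy].
elim: w => //= z w IH; case: (z =P y) => [->|/eqP zy] /=.
  by rewrite eq_sym (negbTE xy) /= eqxx.
by case: (z =P x) => //= _; rewrite (negbTE zy) IH.
Qed.

Lemma pushC x y w : e x.1 y.1 -> teq (push x (push y w)) (push y (push x w)).
Proof.
move=> exy.
have xy : ~~ dep (inv x) y by rewrite /dep negbK.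
have yx : ~~ dep (inv y) x by rewrite /dep negbK e_sym.
have nxy : (x == inv y) = false by apply: contraTF exy => /eqP->; rewrite /= e_irr.
have nyx : (y == inv x) = false by apply: contraTF exy => /eqP->; rewrite /= e_irr.
have E : proj =2 proj by [].
rewrite {1}/push starts_push //  {3}/push starts_push // /push.
case: (starts (inv x) w); case: (starts (inv y) w).
- by rewrite remC.
- by rewrite /= nyx.
- by rewrite /= nxy.
by have := @starts_rem y (x :: y :: w); rewrite starts_cons dep_sym
  (negbTE (_ : ~~ dep x y)) // starts_consx /= => /(_ isT);
  rewrite eqxx; case: (x =P y) => // xy'; move: exy; rewrite xy' e_irr.
Qed.

Definition pushs (u w : word) := foldr push w u.

Lemma red_pushs u w : red w -> red (pushs u w).
Proof. by move=> redw; elim: u => //= x u; exact: red_push. Qed.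
Lemma teq_pushs u v w : teq v w -> teq (pushs u v) (pushs u w).
Proof. by move=> vw; elim: u => //= x u; exact: teq_push. Qed.

(** The word problem: letters act on reduced words up to [teq], and this action
    satisfies the defining relations of the group.  Acting on the empty word gives
    a normal form. *)
Lemma eqv_pushs u v : eqv u v -> forall w, red w -> teq (pushs u w) (pushs v w).
Proof.
elim=> {u v} // [u v _ IH w redw|u v w _ IH1 _ IH2 x rx|u u' v v' _ IH1 _ IH2 w redw|x w redw|v w vw u ru].
- exact/teq_sym/IH.
- by apply: teq_trans (IH1 _ rx) (IH2 _ rx).
- rewrite /pushs !foldr_cat; apply: teq_trans (IH1 _ (red_pushs v redw)) _.
  exact/teq_pushs/IH2.
- exact: pushV.
rewrite /pushs /=.
apply: teq_trans (pushV (v, true) ru).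
apply: teq_push.
apply: (@teq_trans (push (w, true) (push (w, false) (push (v, false) u)))).
  by apply/teq_push/pushC.
by apply: (@pushV (w, true)); exact: red_push.
Qed.

Definition NF u := pushs u [::].

Lemma red_NF u : red (NF u). Proof. exact: red_pushs. Qed.
Lemma eqv_NF u v : eqv u v -> teq (NF u) (NF v).
Proof. by move/eqv_pushs; apply. Qed.
Lemma NF_red u : red u -> NF u = u.
Proof.
elim: u => //= x u IH /andP[sx ru].
by rewrite /NF /= -/(NF u) IH // /push (negbTE sx).
Qed.
Lemma push_eqv x w : eqv (push x w) (x :: w).
Proof.
rewrite /push; case: ifP => [sw|_]; last exact: WRefl.
apply: WSym; apply: WTrans (eqv_cons x (starts_eqv sw)) _.
rewrite -[X in eqv _ X]cat0s -(cat1s x) -(cat1s (inv x)) catA.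
by apply: WCat; [exact: WCancel | exact: WRefl].
Qed.
Lemma NF_eqv u : eqv (NF u) u.
Proof.
elim: u => [|x u IH]; first exact: WRefl.
by apply: WTrans (push_eqv x _) _; exact: eqv_cons.
Qed.
Lemma red_eqv_teq u v : red u -> red v -> eqv u v -> teq u v.
Proof. by move=> /NF_red{2}<- /NF_red{2}<- /eqv_NF. Qed.

Lemma size_push x w : size (push x w) <= (size w).+1.
Proof.
rewrite /push; case: ifP => // sw; rewrite size_rem ?starts_mem //.
by case: (size w) => // n; rewrite leqW // leqW.
Qed.
Lemma size_NF u : size (NF u) <= size u.
Proof. by elim: u => //= x u IH; apply: leq_trans (size_push _ _) _. Qed.
Lemma size_NF_red u : size (NF u) = size u -> red u.
Proof.
elim: u => //= x u IH; rewrite /NF /= -/(NF u) /push.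
case: ifP => [sw|sw /= [E]].
  have := size_NF u; have := starts_mem sw => /[dup] m /size_rem ->.
  by case: (NF u) m => //= _ s _; lia.
by rewrite (NF_red (IH E)) in sw; rewrite sw IH.
Qed.

Lemma cnt_NF a u : cnt a (NF u) <= cnt a u.
Proof.
elim: u => //= x u IH; rewrite /NF /= -/(NF u) /push.
case: ifP => [sw|_]; last by rewrite leq_add2l.
apply: leq_trans (_ : cnt a (NF u) <= _).
  rewrite (teq_cnt a (starts_rem sw)) /cnt /= leq_addl //.
by apply: leq_trans IH _; rewrite leq_addl.
Qed.

(** Reduced words are exactly the words of minimal length, a property that is
    plainly invariant under reversal and under inverting all letters. *)
Lemma red_min u : (forall v, eqv u v -> size u <= size v) -> red u.
Proof.
move=> H; apply: size_NF_red; apply/eqP; rewrite eqn_leq size_NF /=.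
exact/H/WSym/NF_eqv.
Qed.
Lemma red_le u v : red u -> eqv u v -> size u <= size v.
Proof.
by move=> ru /eqv_NF /teq_size; rewrite NF_red // => ->; exact: size_NF.
Qed.

Lemma eqv_rev u v : eqv u v -> eqv (rev u) (rev v).
Proof.
elim=> {u v} [u|u v _ IH|v u w _ IH1 _ IH2|u u' v v' _ IH1 _ IH2|x|v w vw].
- exact: WRefl.
- exact: WSym.
- exact: WTrans IH1 IH2.
- by rewrite !rev_cat; apply: WCat.
- by have := WCancel e (inv x); rewrite invK.
rewrite /rev /=; apply: (@WTrans _ _ [:: (w, false); (w, true); (v, false); (v, true)]).
  by apply/eqv_cons/(@WCat _ _ [:: _; _] [:: _; _] [:: _]);
     [apply: eqv_comm | exact: WRefl].
by apply: (@WCat _ _ [:: _; _] [::] [:: _; _] [::]); apply: (WCancel _ (_, false)).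
Qed.

Lemma eqv_inv u v : eqv u v -> eqv (map inv u) (map inv v).
Proof.
elim=> {u v} [u|u v _ IH|v u w _ IH1 _ IH2|u u' v v' _ IH1 _ IH2|x|v w vw].
- exact: WRefl.
- exact: WSym.
- exact: WTrans IH1 IH2.
- by rewrite !map_cat; apply: WCat.
- exact: WCancel.
apply: (@WTrans _ _ [:: (v, false); (v, true); (w, false); (w, true)]).
  by apply/eqv_cons/(@WCat _ _ [:: _; _] [:: _; _] [:: _]);
     [apply: eqv_comm; rewrite e_sym | exact: WRefl].
by apply: (@WCat _ _ [:: _; _] [::] [:: _; _] [::]); apply: (WCancel _ (_, false)).
Qed.

Lemma red_rev u : red u -> red (rev u).
Proof.
move=> ru; apply: red_min => v uv; rewrite size_rev -(size_rev v).
by apply: red_le => //; rewrite -(revK u); exact: eqv_rev.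
Qed.
Lemma red_inv u : red u -> red (map inv u).
Proof.
move=> ru; apply: red_min => v uv; rewrite size_map -(size_map inv v).
apply: red_le => //; rewrite -[u](mapK invK); exact: eqv_inv.
Qed.
Lemma red_inv_word u : red u -> red (inv_word u).
Proof. by move=> ru; apply/red_rev/red_inv. Qed.

Lemma red_catr u v : red (u ++ v) -> red v.
Proof. by elim: u => //= x u IH /andP[_]. Qed.
Lemma red_catl u v : red (u ++ v) -> red u.
Proof.
by move=> /red_rev; rewrite rev_cat => /red_catr /red_rev; rewrite revK.
Qed.

Definition ends (x : letter) (w : word) := starts x (rev w).

Lemma ends_cat x u v : ends x v -> ends x (u ++ v).
Proof. by rewrite /ends rev_cat; exact: starts_cat. Qed.
Lemma ends_teq x u v : teq u v -> ends x u -> ends x v.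
Proof. by move/teq_rev/starts_teq; apply. Qed.
Lemma ends_rcons_eqv x w : ends x w -> exists w', teq w (rcons w' x).
Proof.
move=> /starts_cons_eqv[w' /teq_rev]; rewrite revK rev_cons.
by exists (rev w').
Qed.

(** If every letter satisfying [P] commutes with every letter that does not, the
    projection to a nonadjacent pair only sees letters of one of the two kinds. *)
Lemma teq_filter (P : pred letter) (u : word) :
  (forall x y, x \in u -> y \in u -> P x -> ~~ P y -> e x.1 y.1) ->
  teq u (filter P u ++ filter (predC P) u).
Proof.
move=> H b d bd; have fC (Q R : pred letter) s : filter Q (filter R s) = filter R (filter Q s).
  by rewrite -!filter_predI; apply: eq_filter => x /=; rewrite andbC.
rewrite /proj filter_cat (fC _ P) (fC _ (predC P)) -/(proj b d u).
have same : {in proj b d u &, forall x y, P x = P y}.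
  have K x y : x \in proj b d u -> y \in proj b d u -> P x -> P y.
    rewrite !mem_filter => /andP[xb xu] /andP[yb yu] Px; apply: contraNT bd => Py.
    have := H x y xu yu Px Py.
    by case/orP: xb => /eqP->; case/orP: yb => /eqP->; rewrite ?e_irr // e_sym.
  by move=> x y hx hy; apply/idP/idP; apply: K.
case: (proj b d u) same => // x l same.
have sx y : y \in x :: l -> P y = P x by move=> yl; rewrite (same y x) ?mem_head.
have nil (Q : pred letter) : {in x :: l, forall y, ~~ Q y} -> filter Q (x :: l) = [::].
  by move=> HQ; apply/eqP; rewrite -[_ == _]negbK -has_filter; apply/hasPn.
have full (Q : pred letter) : {in x :: l, forall y, Q y} -> filter Q (x :: l) = x :: l.
  by move=> HQ; apply/all_filterP/allP.
case Px: (P x).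
  by rewrite full ?nil ?cats0 // => y /sx /= ->; rewrite Px.
by rewrite nil ?full // => y /sx /= ->; rewrite Px.
Qed.

Lemma red_catN u v : red u -> red v -> ~~ red (u ++ v) ->
  exists2 x, ends x u & starts (inv x) v.
Proof.
move=> + rv; elim: u => [|y u IH] /=; first by rewrite rv.
move=> /andP[sy ru]; case: (boolP (red (u ++ v))) => [ruv|nr _]; last first.
  by have [x xu xv] := IH ru nr; exists x => //; rewrite -cat1s ends_cat.
rewrite andbT negbK; move: sy; rewrite /starts filter_cat.
case E: (filter _ u) => [|z s] /=; last by move=> /negbTE->.
move=> _ sv; exists y; last exact: sv.
rewrite /ends /starts filter_rev /= depxx.
by move: E; rewrite -/(dep y) => ->.
Qed.

(** Cancellation in a product of reduced words happens at the interface, so the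
    cancelled part is a common piece [c], a suffix of [u] and inverted a prefix of
    [v]. *)
Lemma cancel_cat u v : red u -> red v -> exists u1 c v1,
  [/\ teq u (u1 ++ c), teq v (inv_word c ++ v1) & red (u1 ++ v1)].
Proof.
have [n] := ubnP (size u); elim: n u v => // n IH u v un ru rv.
case: (boolP (red (u ++ v))) => [ruv|/(red_catN ru rv)[x xu xv]].
  by exists u, [::], v; rewrite cats0.
have [u' uu'] := ends_rcons_eqv xu; have [v' vv'] := starts_cons_eqv xv.
have su : size u' < n by move: un; rewrite (teq_size uu') size_rcons.
have ru' : red u' by have := red_teq uu' ru; rewrite -cats1 => /red_catl.
have rv' : red v' by have := red_teq vv' rv; rewrite /= => /andP[].
have [u1 [c [v1 [h1 h2 h3]]]] := IH _ v' su ru' rv'.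
exists u1, (rcons c x), v1; split=> //.
  apply: teq_trans uu' _; rewrite -!cats1 catA; exact: teq_cat.
by apply: teq_trans vv' _; rewrite /inv_word map_rcons rev_rcons /=; apply: teq_cons.
Qed.


(** * Letter counts of group elements *)

Local Notation raag := (raag e).
Local Notation we := (word_elt e).
Local Notation gen := (raag_gen e).

Local Arguments cnt _ _ : simpl never.

Definition nf (g : raag) : word := NF (repr g).
Definition occ (a : V) (g : raag) := cnt a (nf g).
Definition lelt (x : letter) : raag := we [:: x].

Lemma we_eq u v : eqv u v -> we u = we v. Proof. by move=> uv; apply/word_eltP. Qed.
Lemma we_teq u v : teq u v -> we u = we v. Proof. by move/teq_eqv/we_eq. Qed.
Lemma we_cat u v : we (u ++ v) = (we u * we v)%g. Proof. by rewrite -raag_mulE. Qed.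
Lemma we_cons x u : we (x :: u) = (lelt x * we u)%g. Proof. by rewrite -we_cat. Qed.
Lemma we_nil : we [::] = 1%g. Proof. by []. Qed.
Lemma we_inv u : we (inv_word u) = ((we u)^-1)%g.
Proof.
symmetry; apply: mulg1_eq; rewrite -we_cat; apply: we_eq; exact: word_eqv_mulV.
Qed.
Lemma leltV x : lelt (inv x) = ((lelt x)^-1)%g. Proof. by rewrite -we_inv. Qed.
Lemma lelt_gen v b : lelt (v, b) = if b then gen v else ((gen v)^-1)%g.
Proof. by case: b => //; rewrite -leltV. Qed.

Lemma red_nf g : red (nf g). Proof. exact: red_NF. Qed.
Lemma nfK g : we (nf g) = g.
Proof. by rewrite (we_eq (NF_eqv _)) word_eltK. Qed.
Lemma nf_we u : red u -> teq u (nf (we u)).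
Proof. by move=> ru; apply: red_eqv_teq; rewrite ?red_nf //; apply/word_eltP; rewrite nfK. Qed.
Lemma nf_eq g u : red u -> we u = g -> teq (nf g) u.
Proof. by move=> ru <-; apply/teq_sym/nf_we. Qed.
Lemma occ_we a u : red u -> occ a (we u) = cnt a u.
Proof. by move/nf_we/(teq_cnt a). Qed.
Lemma occ_we_le a u : occ a (we u) <= cnt a u.
Proof.
apply: leq_trans (cnt_NF _ _); rewrite -(occ_we _ (red_NF _)).
by rewrite (we_eq (NF_eqv u)).
Qed.

Lemma cnt_cat a u v : cnt a (u ++ v) = cnt a u + cnt a v. Proof. exact: count_cat. Qed.
Lemma cnt_cons a x u : cnt a (x :: u) = (x.1 == a) + cnt a u. Proof. by []. Qed.
Lemma cnt_map_inv a u : cnt a (map inv u) = cnt a u. Proof. exact: count_map. Qed.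
Lemma cnt_rev a u : cnt a (rev u) = cnt a u. Proof. exact: count_rev. Qed.
Lemma cnt_inv_word a u : cnt a (inv_word u) = cnt a u.
Proof. by rewrite /inv_word cnt_rev cnt_map_inv. Qed.

Lemma mul_cancel g h : exists u1 c v1,
  [/\ teq (nf g) (u1 ++ c), teq (nf h) (inv_word c ++ v1), red (u1 ++ v1)
    & (g * h)%g = we (u1 ++ v1)].
Proof.
have [u1 [c [v1 [h1 h2 h3]]]] := cancel_cat (red_nf g) (red_nf h).
exists u1, c, v1; split=> //.
rewrite -(nfK g) -(nfK h) (we_teq h1) (we_teq h2) !we_cat we_inv.
by rewrite -!mulgA mulVKg.
Qed.

Lemma occ1 a : occ a 1%g = 0. Proof. by rewrite -we_nil occ_we. Qed.
Lemma occ_lelt a x : occ a (lelt x) = (x.1 == a). Proof. by rewrite occ_we // /cnt /= addn0. Qed.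
Lemma occ_inv a g : occ a (g^-1)%g = occ a g.
Proof.
by rewrite -{1}(nfK g) -we_inv occ_we ?cnt_inv_word //; apply/red_inv_word/red_nf.
Qed.
Lemma occ_mul a g h : exists2 k, occ a g + occ a h = occ a (g * h)%g + k.*2 &
   k <= occ a g /\ k <= occ a h.
Proof.
have [u1 [c [v1 [h1 h2 h3 ->]]]] := mul_cancel g h.
rewrite occ_we // /occ (teq_cnt a h1) (teq_cnt a h2) !cnt_cat cnt_inv_word.
by exists (cnt a c); lia.
Qed.
Lemma occ_sub a g h : occ a (g * h)%g <= occ a g + occ a h.
Proof. by have [k -> _] := occ_mul a g h; rewrite leq_addr. Qed.
Lemma odd_occ_mul a g h : odd (occ a (g * h)%g) = odd (occ a g) (+) odd (occ a h).
Proof. by have [k /(congr1 odd)] := occ_mul a g h; rewrite !oddD odd_double addbF => ->. Qed.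
Lemma occ0r a g h : occ a h = 0 -> occ a (g * h)%g = occ a g.
Proof. by move=> h0; have [k] := occ_mul a g h; lia. Qed.
Lemma occ0l a g h : occ a g = 0 -> occ a (g * h)%g = occ a h.
Proof. by move=> h0; have [k] := occ_mul a g h; lia. Qed.

Definition invgens (g : raag) : raag := we (map inv (repr g)).
(** Palindromes satisfy this, but so does any product of two distinct adjacent
    generators, which is no palindrome; unlike the latter notion, symmetry is
    stable under products of commuting elements. *)
Definition sym g := invgens g = (g^-1)%g.

Lemma invgens_we u : invgens (we u) = we (map inv u).
Proof. by apply/we_eq/eqv_inv/word_eltP; rewrite word_eltK. Qed.
Lemma invgensM : {morph invgens : g h / (g * h)%g}.
Proof.
by move=> g h; rewrite -(nfK g) -(nfK h) -we_cat !invgens_we map_cat we_cat.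
Qed.
Lemma invgens_gen v : invgens (gen v) = ((gen v)^-1)%g.
Proof. by rewrite invgens_we -we_inv. Qed.

Lemma sym_we u : sym (we u) <-> eqv (rev u) u.
Proof.
rewrite -word_eltP /sym invgens_we -(inv_wordK (rev u)) we_inv.
have -> : inv_word (rev u) = map inv u by rewrite /inv_word map_rev revK.
by split=> [->|<-]; rewrite invgK.
Qed.
(** Both words represent the same element and are reduced. *)
Lemma sym_nf g : sym g <-> teq (nf g) (rev (nf g)).
Proof.
rewrite -{1}(nfK g) sym_we; split=> [H|/teq_eqv /WSym //].
by apply: red_eqv_teq; rewrite ?red_rev ?red_nf //; exact: WSym.
Qed.
Lemma symV g : sym g -> sym (g^-1)%g.
Proof.
move=> sg; have : invgens (g * g^-1)%g = 1%g by rewrite mulgV -we_nil invgens_we.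
by rewrite invgensM sg => /mulg1_eq E; rewrite /sym -E.
Qed.
Lemma symM g h : commute g h -> sym g -> sym h -> sym (g * h)%g.
Proof. by move=> gh sg sh; rewrite /sym invgensM sg sh gh invgM. Qed.
Lemma symX g n : sym g -> sym (g ^+ n)%g.
Proof.
move=> sg; elim: n => [|n IH]; first by rewrite /sym expg0 -we_nil invgens_we -we_inv.
by rewrite expgS; apply: symM => //; apply: commuteX.
Qed.
Lemma sym_lelt x : sym (lelt x).
Proof. by rewrite /lelt sym_we; exact: WRefl. Qed.

(** If a letter [a] is lost, the cancelled piece contains the last [a] of [g] and
    the first [a] of [h]. *)
Lemma occ_lt_cancel a g h : occ a (g * h)%g < occ a g + occ a h ->
  exists2 x, ohead (proj a a (rev (nf g))) = Some x &
             ohead (proj a a (nf h)) = Some (inv x).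
Proof.
have [u1 [c [v1 [h1 h2 h3 ->]]]] := mul_cancel g h.
rewrite occ_we // /occ (teq_cnt a h1) (teq_cnt a h2) !cnt_cat cnt_inv_word => hlt.
have : 0 < cnt a (rev c) by rewrite cnt_rev; lia.
rewrite (teq_rev h1) ?e_irr // (h2 a a) ?e_irr // rev_cat /proj !filter_cat -!/(proj _ _ _).
rewrite /inv_word -map_rev proj_inv cntE.
by case: (proj a a (rev c)) => //= x s _; exists x.
Qed.

(** Since [h] is symmetric, its first letter [a] and that of its inverse have
    opposite signs, and only one of them can cancel the last [a] of [g]. *)
Lemma occ_dichotomy a g h : sym g -> sym h ->
  occ a (g * h)%g = occ a g + occ a h \/ occ a (g * h^-1)%g = occ a g + occ a h.
Proof.
move=> sg sh; have := occ_sub a g h; have := occ_sub a g (h^-1)%g; rewrite occ_inv.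
rewrite leq_eqVlt => /orP[/eqP|l2]; first by right.
rewrite leq_eqVlt => /orP[/eqP|l1]; first by left.
have [x hx1 hx2] := occ_lt_cancel l1.
have [y] : exists2 y, ohead (proj a a (rev (nf g))) = Some y &
             ohead (proj a a (nf (h^-1)%g)) = Some (inv y).
  by apply: occ_lt_cancel; rewrite occ_inv.
rewrite hx1 => -[<-].
have E : teq (nf (h^-1)%g) (map inv (nf h)).
  apply: nf_eq; first exact/red_inv/red_nf.
  by rewrite -invgens_we nfK.
rewrite E ?e_irr // proj_inv.
case: (proj a a (nf h)) hx2 => //= z s [->] /Some_inj Ei.
by have := inv_neq (inv x); rewrite Ei eqxx.
Qed.

(** Apply the dichotomy to [g ^+ n.+1] and [g]: the alternative is
    [occ a (g ^+ n) = occ a (g ^+ n.+1) + occ a g], which by induction forces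
    [occ a g = 0]. *)
Lemma occ_exp a g n : sym g -> occ a (g ^+ n)%g = n * occ a g.
Proof.
move=> sg; have [m] := ubnP n; elim: m n => // m IH [|[|n]] nm.
- by rewrite expg0 occ1.
- by rewrite expg1 mul1n.
have := occ_dichotomy a (symX n.+1 sg) sg.
have -> : (g ^+ n.+1 * g^-1 = g ^+ n)%g by rewrite expgSr mulgK.
rewrite -expgSr (IH n.+1) ?(IH n); try lia.
case=> H; first by rewrite H !mulSn; lia.
have g0 : occ a g = 0 by move: H; rewrite mulSn; lia.
have := occ_sub a (g ^+ n.+1)%g g; rewrite -expgSr (IH n.+1) // g0 !muln0.
by case: (occ a _).
Qed.

(** The dichotomy for [g * h] and [g * h^-1], whose product and quotient are
    [g ^+ 2] and [h ^+ 2], determines the smaller of the two counts. *)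
Lemma occ_diff a g h : sym g -> sym h -> commute g h -> exists b : bool,
  occ a (g * (if b then h else h^-1))%g = (occ a g - occ a h) + (occ a h - occ a g).
Proof.
move=> sg sh gh; have ghV := commuteV gh; have shV := symV sh.
have s1 := symM gh sg sh; have s2 := symM ghV sg shV.
have E1 : (g * h * (g * h^-1) = g ^+ 2)%g.
  by rewrite mulgA -(mulgA g) -gh mulgA mulgK expg2.
have E2 : (g * h * (g * h^-1)^-1 = h ^+ 2)%g.
  by rewrite invgM invgK gh mulgA -(mulgA h) gh mulgA mulgK expg2.
have := occ_dichotomy a s1 s2; rewrite E1 E2 !occ_exp //.
have [] := occ_dichotomy a sg sh => H; rewrite H.
  case=> K; exists false; move: K; rewrite /=; set k := occ a (g / h)%g => K; lia.
by case=> K; exists true; move: K; rewrite /=; set k := occ a (g * h)%g => K; lia.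
Qed.

(** If [w] occurs, the number of letters [x <> w] in front of the first [w]; for
    nonadjacent [x] and [w] it only depends on the trace. *)
Definition before (x w : V) (u : word) := find (fun y => y.1 == w) (proj x w u).

Lemma before_le x w u : x != w -> before x w u <= cnt x u.
Proof.
move=> xw; rewrite /before /cnt /proj; elim: u => //= y u IH.
case: (y.1 =P x) => [yx|] /=; first by rewrite yx (negbTE xw).
by case: (y.1 =P w) => yw /=; rewrite ?yw ?eqxx.
Qed.


Lemma before_catr x w u v : x != w -> cnt w u = 0 ->
  before x w (u ++ v) = cnt x u + before x w v.
Proof.
move=> xw; elim: u => //= y u IH; rewrite cnt_cons.
case: (y.1 =P w) => // /eqP yw /= u0.
rewrite cnt_cons -addnA -(IH u0) /before /proj /= (negbTE yw) orbF.
by case: (y.1 =P x) => //= _; rewrite (negbTE yw).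
Qed.

Lemma before_catl x w u v : 0 < cnt w u -> before x w (u ++ v) = before x w u.
Proof.
rewrite /before /proj; elim: u => //= y u IH; rewrite cnt_cons.
case: (y.1 =P w) => [yw|yw] /=; first by rewrite orbT /= yw eqxx.
rewrite add0n orbF => u0; case: ifP => /= _; last exact: IH.
by case: eqP => // _; rewrite IH.
Qed.

Lemma before_teq x w u v : ~~ e x w -> teq u v -> before x w u = before x w v.
Proof. by move=> xw uv; rewrite /before uv. Qed.

(** If [x] and [w] were not adjacent, many letters [x] would stand before the first
    [w] of [q ^+ n * p], whereas in [p * q ^+ n] at most those of [p] can. *)
Lemma commute_link p q w x : commute p q -> sym q -> 0 < occ w p -> occ w q = 0 ->
  0 < occ x q -> e x w.
Proof.
move=> pq sq wp wq xq; case: (boolP (e x w)) => // nxw; exfalso.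
have xw : x != w by apply: contraTneq xq => ->; rewrite wq.
pose B g := before x w (nf g).
have Bl g h : occ w h = 0 -> occ x h <= B (h * g)%g + occ x g.
  have [u1 [c [v1 [h1 h2 h3 ->]]]] := mul_cancel h g.
  rewrite /occ (teq_cnt w h1) cnt_cat => h0.
  rewrite /B -(before_teq nxw (nf_we h3)) before_catr //; last by lia.
  by rewrite (teq_cnt x h1) (teq_cnt x h2) !cnt_cat cnt_inv_word; lia.
have Br g h : occ w h = 0 -> 0 < occ w g -> B (g * h)%g <= occ x g.
  have [u1 [c [v1 [h1 h2 h3 ->]]]] := mul_cancel g h.
  rewrite /occ (teq_cnt w h2) (teq_cnt w h1) !cnt_cat cnt_inv_word => h0 g0.
  rewrite /B -(before_teq nxw (nf_we h3)) before_catl //; last by lia.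
  rewrite (teq_cnt x h1) cnt_cat; apply: leq_trans (before_le _ xw) _.
  exact: leq_addr.
(* The letters [x] of [p] are counted twice: some may cancel against
   [q ^+ n], and some may precede [w] in [p]. *)
pose n := ((occ x p).*2).+1.
have qn0 : occ w (q ^+ n)%g = 0 by rewrite occ_exp // wq muln0.
have := Bl p _ qn0; have := Br p _ qn0 wp.
rewrite (commuteX n pq) occ_exp //.
have : n <= n * occ x q by rewrite leq_pmulr.
by move: (n * occ x q) (B _) => z y; rewrite /n; lia.
Qed.

(** [p ^+ occ w q] and [q ^+ occ w p] contain equally many letters [w], so one of
    their product and their quotient contains none by [occ_diff]. *)
Lemma axis_link p q w : commute p q -> sym p -> sym q -> 0 < occ w p ->
  exists b : bool, let r := (p ^+ occ w q * (if b then q ^+ occ w p else q ^- occ w p))%g in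
  [/\ sym r, commute p r & forall x, 0 < occ x r -> e x w].
Proof.
move=> pq sp sq wp.
have spn := symX (occ w q) sp; have sqm := symX (occ w p) sq.
have cpq : commute (p ^+ occ w q)%g (q ^+ occ w p)%g by exact: commuteX2.
have [b Hb] := occ_diff w spn sqm cpq.
exists b; move=> r.
have cr : commute p r.
  apply: commuteM; first by apply: commuteX.
  by case: (b); [|apply: commuteV]; apply: commuteX.
have sr : sym r by apply: symM; case: (b) => //; [exact: commuteV | exact: symV].
split=> // x; apply: (commute_link cr sr wp).
by rewrite Hb !occ_exp // mulnC !subnn.
Qed.

(** * Homomorphisms and automorphisms *)

Lemma morph1 (G H : groupType) (f : G -> H) : {morph f : x y / (x * y)%g} -> f 1%g = 1%g.
Proof. by move=> fM; apply: (@mulgI _ (f 1%g)); rewrite -fM !mulg1. Qed.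
Lemma morphV (G H : groupType) (f : G -> H) : {morph f : x y / (x * y)%g} ->
  {morph f : x / (x^-1)%g}.
Proof. by move=> fM x; symmetry; apply: mulg1_eq; rewrite -fM mulgV morph1. Qed.
Lemma morphX (G H : groupType) (f : G -> H) n : {morph f : x y / (x * y)%g} ->
  {morph f : x / (x ^+ n)%g}.
Proof.
move=> fM x; elim: n => [|n IH]; first by rewrite !expg0 morph1.
by rewrite !expgS fM IH.
Qed.

Lemma raag_ind (P : raag -> Prop) : P 1%g ->
  (forall x g, P g -> P (lelt x * g)%g) -> forall g, P g.
Proof.
move=> P1 PM g; rewrite -(nfK g); elim: (nf g) => // x w IH.
by rewrite we_cons; exact: PM.
Qed.

Lemma morph_ext (H : groupType) (f g : raag -> H) :
  {morph f : x y / (x * y)%g} -> {morph g : x y / (x * y)%g} ->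
  (forall v, f (gen v) = g (gen v)) -> f =1 g.
Proof.
move=> fM gM fg; elim/raag_ind => [|[v b] h IH]; first by rewrite !morph1.
by rewrite fM gM IH lelt_gen; case: b; rewrite ?morphV // fg.
Qed.

Lemma lelt_comm x y : e x.1 y.1 -> commute (lelt x) (lelt y).
Proof.
by move=> exy; rewrite /commute /= -!we_cat; apply/we_eq/eqv_comm.
Qed.
Lemma gen_comm v w : e v w -> commute (gen v) (gen w).
Proof. by move=> ?; exact: (@lelt_comm (v, true) (w, true)). Qed.

Lemma commute_supp r w : (forall x, 0 < occ x r -> e x w) -> commute r (gen w).
Proof.
move=> H; rewrite -(nfK r).
have: {in nf r, forall x, e x.1 w}.
  move=> x xr; apply: H; rewrite /occ /cnt -has_count; apply/hasP; exists x => //.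
elim: (nf r) => [|x u IH] Hu; first by rewrite we_nil; exact/commute_sym/commute1.
rewrite we_cons; apply/commute_sym/commuteM; apply: commute_sym.
  by apply: (@lelt_comm x (w, true)); apply: Hu; rewrite inE eqxx.
by apply: IH => y yu; apply: Hu; rewrite inE yu orbT.
Qed.

Definition evl (f : V -> raag) (x : letter) : raag := if x.2 then f x.1 else ((f x.1)^-1)%g.
Definition ev f (w : word) : raag := foldr (fun x g => evl f x * g)%g 1%g w.
Definition ext f (g : raag) : raag := ev f (repr g).

Lemma ev_cat f u v : ev f (u ++ v) = (ev f u * ev f v)%g.
Proof. by elim: u => [|x u IH] /=; rewrite ?mul1g // IH mulgA. Qed.

Section Extension.
Variable f : V -> raag.
Hypothesis fC : forall v w, e v w -> commute (f v) (f w).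

Lemma ev_eqv u v : eqv u v -> ev f u = ev f v.
Proof.
elim=> {u v} // [u v w _ -> _ -> //|u u' v v' _ uu _ vv|[v []]|v w vw].
- by rewrite !ev_cat uu vv.
- by rewrite /= mulg1 mulgV.
- by rewrite /= mulg1 mulVg.
rewrite /= /evl /= mulg1.
have := fC vw; rewrite /commute /= => E.
by rewrite mulgA E mulgA -(mulgA (f w)) mulgV mulg1 mulgV.
Qed.
Lemma ext_we u : ext f (we u) = ev f u.
Proof. by apply/ev_eqv/word_eltP; rewrite word_eltK. Qed.
Lemma extM : {morph ext f : x y / (x * y)%g}.
Proof. by move=> x y; rewrite -(nfK x) -(nfK y) -we_cat !ext_we ev_cat. Qed.
Lemma ext_gen v : ext f (gen v) = f v.
Proof. by rewrite ext_we /= mulg1. Qed.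
End Extension.

(** Well-definedness of an automorphism given on generators is witnessed by its
    inverse, also given on generators. *)
Lemma aut_exists (f g : V -> raag) :
  (forall v w, e v w -> commute (f v) (f w)) ->
  (forall v w, e v w -> commute (g v) (g w)) ->
  (forall v, ext f (g v) = gen v) -> (forall v, ext g (f v) = gen v) ->
  exists a : autom raag, forall v, a (gen v) = f v.
Proof.
move=> fC gC fg gf.
have aut : automorphism (ext f).
  split; last exact: extM.
  exists (ext g).
    apply: (@morph_ext _ (ext g \o ext f) id) => [x y|//|v] /=.
      by rewrite !extM.
    by rewrite (ext_gen fC).
  apply: (@morph_ext _ (ext f \o ext g) id) => [x y|//|v] /=.
    by rewrite !extM.
  by rewrite (ext_gen gC).
by exists (Autom (asboolT aut)) => v; exact: ext_gen.
Qed.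

Lemma autM (a : autom raag) : {morph a : x y / (x * y)%g}.
Proof. by case: (autP a). Qed.
Lemma autV (a : autom raag) : {morph a : x / (x^-1)%g}.
Proof. exact/morphV/autM. Qed.
Lemma aut_lelt (a : autom raag) v b :
  a (lelt (v, b)) = if b then a (gen v) else ((a (gen v))^-1)%g.
Proof. by rewrite lelt_gen; case: b; rewrite ?autV. Qed.
Lemma aut_eq (a b : autom raag) : (forall v, a (gen v) = b (gen v)) -> a = b.
Proof. by move=> ab; apply/autom_ext/morph_ext => //; exact: autM. Qed.
Lemma autVKg (a : autom raag) g : a ((a^-1)%g g) = g. Proof. exact: autVK. Qed.
Lemma autKg (a : autom raag) g : (a^-1)%g (a g) = g. Proof. exact: autK. Qed.
Lemma autMg (a b : autom raag) g : (a * b)%g g = a (b g). Proof. by []. Qed.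

Definition symaut (a : autom raag) := forall v, sym (a (gen v)).

Lemma symaut_invgens a : symaut a -> forall g, a (invgens g) = invgens (a g).
Proof.
move=> sa; apply: (@morph_ext _ (a \o invgens) (invgens \o a)) => [x y|x y|v] /=.
- by rewrite invgensM autM.
- by rewrite autM invgensM.
by rewrite invgens_gen autV sa.
Qed.
Lemma symaut_sym a g : symaut a -> sym g -> sym (a g).
Proof. by move=> sa sg; rewrite /sym -symaut_invgens // sg autV. Qed.
Lemma symaut_inv a : symaut a -> symaut (a^-1)%g.
Proof.
move=> sa v; rewrite /sym -[LHS](autKg a) symaut_invgens // autVKg.
by rewrite invgens_gen autV.
Qed.

(** Parities of letter counts are additive, so they are determined on generators. *)
Lemma odd_occ_aut (a : autom raag) w (P : pred V) :
  (forall v, odd (occ w (a (gen v))) = P v) ->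
  forall g, odd (occ w (a g)) = odd (count (fun x => P x.1) (nf g)).
Proof.
move=> H g; rewrite -{1}(nfK g); elim: (nf g) => [|[v b] u IH] /=.
  by rewrite we_nil morph1 ?occ1 //; exact: autM.
rewrite we_cons autM odd_occ_mul IH oddD; congr (_ (+) _).
by rewrite aut_lelt; case: b; rewrite ?occ_inv H; case: (P v).
Qed.

(** The automorphisms that preserve symmetry and act trivially on the
    abelianization modulo [2]. *)
Definition pure (a : autom raag) :=
  symaut a /\ forall v w, odd (occ w (a (gen v))) = (v == w).

Lemma pure_odd a g w : pure a -> odd (occ w (a g)) = odd (occ w g).
Proof. by case=> _ H; rewrite (odd_occ_aut (P := fun v => v == w)). Qed.

Lemma occ_gen w v : occ w (gen v) = (v == w). Proof. exact: occ_lelt. Qed.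
Lemma sym_gen v : sym (gen v). Proof. exact: sym_lelt. Qed.

Lemma pure_inv a : pure a -> pure (a^-1)%g.
Proof.
move=> pa; split; first by apply: symaut_inv; case: pa.
move=> v w; rewrite -(pure_odd _ _ pa) autVKg occ_gen; by case: (v == w).
Qed.

Lemma pureM a b : pure a -> pure b -> pure (a * b)%g.
Proof.
move=> pa pb; split => v; last first.
  by move=> w; rewrite autMg (pure_odd _ _ pa); case: pb.
by rewrite autMg; apply: symaut_sym; [case: pa|case: pb].
Qed.

Lemma pure_supp a v : pure a -> 0 < occ v (a (gen v)).
Proof. by case=> _ H; have := H v v; rewrite eqxx; case: (occ _ _). Qed.

(** The link of [v] lies in the star of [w]. *)
Definition dom (v w : V) := [forall t, e v t ==> ((t == w) || e t w)].

Lemma domP v w : reflect (forall t, e v t -> t = w \/ e t w) (dom v w).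
Proof.
apply: (iffP forallP) => H t; first by move=> vt; have := H t; rewrite vt /= => /orP[/eqP|]; auto.
by apply/implyP => /H[->|->]; rewrite ?eqxx ?orbT.
Qed.

(** For a neighbour [t] of [v], the images [a v] and [a t] commute, so [axis_link]
    gives a product of their powers that commutes with [w].  Pulled back by [a],
    a product [r0] of powers of [v] and [t] commutes with [a^-1 w], in which [w]
    occurs as it has odd count; [commute_link] then makes [t] adjacent to [w]. *)
Lemma pure_dom a v w : pure a -> 0 < occ w (a (gen v)) -> dom v w.
Proof.
move=> pa wv; apply/domP => t vt.
case: (t =P w) => [->|/eqP flip]; [by left | right].
case: (v =P w) => [<-|/eqP vw]; first by rewrite e_sym.
have [sa oa] := pa.
have pq : commute (a (gen v)) (a (gen t)) by rewrite /commute -!autM (gen_comm vt).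
have [b [sr cr /commute_supp]] := axis_link pq (sa v) (sa t) wv.
set n := occ w (a (gen t)); set m := occ w (a (gen v)) in wv *.
pose r0 : raag := ((gen v) ^+ n * (if b then (gen t) ^+ m else (gen t) ^- m))%g.
have -> : (a (gen v) ^+ n * (if b then a (gen t) ^+ m else a (gen t) ^- m))%g = a r0.
  by rewrite autM; case: (b); rewrite ?autV !(morphX _ (autM a)).
move=> cw.
have cr0 : commute ((a^-1)%g (gen w)) r0.
  by rewrite -(autKg a r0) /commute -!autM cw.
have sr0 : sym r0.
  have vt' : commute (gen v ^+ n)%g (gen t ^+ m)%g by apply/commuteX2/gen_comm.
  apply: symM; last by case: (b); try apply: symV; apply/symX/sym_gen.
    by case: (b) => //; apply: commuteV.
  exact/symX/sym_gen.
have N0 x : x != v -> occ x (gen v ^+ n)%g = 0.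
  by rewrite occ_exp ?occ_gen 1?eq_sym; last exact: sym_gen; move=> /negbTE->; rewrite muln0.
have Nt x : occ x (if b then gen t ^+ m else gen t ^- m)%g = m * (t == x).
  by case: (b); rewrite ?occ_inv occ_exp ?occ_gen //; exact: sym_gen.
have tv : t != v by apply: contraTneq vt => ->; rewrite e_irr.
apply: (commute_link cr0 sr0).
- exact: (pure_supp _ (pure_inv pa)).
- by rewrite /r0 occ0l ?Nt ?(negbTE flip) ?muln0 // N0 // eq_sym.
- by rewrite /r0 occ0l ?Nt ?eqxx ?muln1 // N0.
Qed.

(** In the element [r] of [axis_link] the exponent of [a v] is even and that of
    [a t] is odd, so [s'] has odd count in [r]. *)
Lemma odd_class_edge a v t s s' : symaut a -> s != s' -> e v t ->
  (forall w, odd (occ w (a (gen v))) = (s == w)) ->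
  (forall w, odd (occ w (a (gen t))) = (s' == w)) -> e s s'.
Proof.
move=> sa ss vt Hv Ht.
have pq : commute (a (gen v)) (a (gen t)) by rewrite /commute -!autM (gen_comm vt).
have sv : odd (occ s (a (gen v))) by rewrite Hv eqxx.
have [b [sr cr Hr]] := axis_link pq (sa v) (sa t) (odd_gt0 sv).
rewrite e_sym; apply: Hr; apply: odd_gt0.
have ssF : (s == s') = false by exact: negbTE.
have s'sF : (s' == s) = false by rewrite eq_sym.
rewrite odd_occ_mul; case: (b); rewrite ?occ_inv !occ_exp // !oddM ?Hv ?Ht !eqxx ?ssF ?s'sF //=.
Qed.

(** * Reduction to irreducible automorphisms *)

Local Notation Gen := (generated_subgroup (palindromic_gens e)).

Lemma Gen_subgroup : subgroup Gen.
Proof.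
split.
- by move=> A [[A1 _ _] _].
- by move=> x y Gx Gy A AP; have [[_ AM _] _] := AP; apply: AM; [exact: Gx|exact: Gy].
- by move=> x Gx A AP; have [[_ _ AV] _] := AP; apply: AV; exact: Gx.
Qed.
Lemma Gen_sub a : palindromic_gens e a -> Gen a.
Proof. by move=> Sa A [_ SA]; exact: SA. Qed.

Lemma dom_refl v : dom v v.
Proof. by apply/domP => t vt; right; rewrite e_sym. Qed.

Lemma dom_trans w v z : dom v w -> dom w z -> dom v z.
Proof.
move=> /domP vw /domP wz; apply/domP => t vt.
have [flip|flip] := vw t vt; last by apply: wz; rewrite e_sym.
have [wz'|] : v = z \/ e v z by apply: wz; rewrite -flip e_sym.
  by right; rewrite -wz' e_sym.
move=> /vw[->|zw]; last by right; rewrite flip e_sym.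
by left.
Qed.

Lemma conj2_cancel (G : groupType) (x g : G) : (x^-1 * (x * g * x) * x^-1)%g = g.
Proof. by rewrite -!mulgA mulgV mulg1 mulKg. Qed.

(** The two signs of [j] give mutually inverse maps; treating both at once halves
    the work. *)
Lemma P_exists i j : i != j -> dom i j -> exists a : autom raag, is_P i j a.
Proof.
move=> ij /domP dij.
pose f (x : raag) v := if v == i then (x * gen i * x)%g else gen v.
have fC (b : bool) v w : e v w -> commute (f (lelt (j, b)) v) (f (lelt (j, b)) w).
  have C t : e i t -> commute (f (lelt (j, b)) i) (gen t).
    move=> it; rewrite /f eqxx; apply: commute_sym.
    have tj : commute (gen t) (lelt (j, b)).
      rewrite lelt_gen; have [->|tj] := dij t it.
        by case: (b); [|apply: commuteV].
      by case: (b); [|apply: commuteV]; exact: gen_comm.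
    by apply: commuteM; [apply: commuteM => //; apply: gen_comm; rewrite e_sym|].
  case: (v =P i) => [->|/eqP vi]; case: (w =P i) => [->|/eqP wi] vw //.
  - by rewrite {2}/f (negbTE wi); exact: C.
  - by rewrite {1}/f (negbTE vi); apply: commute_sym; apply: C; rewrite e_sym.
  by rewrite /f (negbTE vi) (negbTE wi); exact: gen_comm.
have fK (b : bool) v : ext (f (lelt (j, b))) (f (lelt (j, ~~ b)) v) = gen v.
  have Ej : ext (f (lelt (j, b))) (gen j) = gen j.
    by rewrite (ext_gen (fC b)) /f eq_sym (negbTE ij).
  have El c : ext (f (lelt (j, b))) (lelt (j, c)) = lelt (j, c).
    by rewrite (lelt_gen j c); case: c; rewrite ?(morphV (extM (fC b))) Ej.
  rewrite {2}/f; case: (v =P i) => [->|/eqP vi].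
    rewrite !(extM (fC b)) El (ext_gen (fC b)) /f eqxx.
    by rewrite -[(j, ~~ b)]/(inv (j, b)) leltV conj2_cancel.
  by rewrite (ext_gen (fC b)) /f (negbTE vi).
have [a aP] := aut_exists (fC true) (fC false) (fK true) (fK false).
exists a; split; first by rewrite aP /f eqxx.
by move=> k ki; rewrite aP /f (negbTE ki).
Qed.

Lemma inversion_exists j : exists a : autom raag, is_inversion j a.
Proof.
pose f v := if v == j then ((gen v)^-1)%g else gen v.
have fC v w : e v w -> commute (f v) (f w).
  move=> /gen_comm vw; rewrite /f; case: ifP; case: ifP => // _ _.
  - by apply: commuteV; apply: commute_sym; apply: commuteV; exact: commute_sym.
  - by apply: commute_sym; apply: commuteV; exact: commute_sym.
  exact: commuteV.
have fK v : ext f (f v) = gen v.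
  rewrite {2}/f; case: ifP => vj.
    by rewrite (morphV (extM fC)) (ext_gen fC) /f vj invgK.
  by rewrite (ext_gen fC) /f vj.
have [a aP] := aut_exists fC fC fK fK.
exists a; split; first by rewrite aP /f eqxx.
by move=> k kj; rewrite aP /f (negbTE kj).
Qed.

Lemma diagram_exists (s : {perm V}) : graph_aut e s ->
  exists2 a : autom raag, diagram_aut a & forall v, a (gen v) = gen (s v).
Proof.
move=> es; pose f v := gen (s v); pose g v := gen ((s^-1)%g v).
have fC v w : e v w -> commute (f v) (f w).
  by move=> vw; apply: gen_comm; rewrite es.
have gC v w : e v w -> commute (g v) (g w).
  by move=> vw; apply: gen_comm; rewrite -es !permKV.
have [a aP] : exists a : autom raag, forall v, a (gen v) = f v.
  by apply: (aut_exists fC gC) => v;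
    rewrite ?(ext_gen fC) ?(ext_gen gC) /f /g ?permKV ?permK.
by exists a => //; exists s.
Qed.

(** [P_ij] and its inverse. *)
Lemma P_sign_exists i j b : i != j -> dom i j -> exists c : autom raag,
  [/\ Gen c, pure c, c (gen i) = (lelt (j, b) * gen i * lelt (j, b))%g &
      forall k, k != i -> c (gen k) = gen k].
Proof.
move=> ij dij; have [a [ai ak]] := P_exists ij dij.
have ji : j != i by rewrite eq_sym.
have Ga : Gen a by apply: Gen_sub; right; right; exists i, j.
have [_ _ GV] := Gen_subgroup.
have [c [Gc ci ck]] : exists c : autom raag,
    [/\ Gen c, c (gen i) = (lelt (j, b) * gen i * lelt (j, b))%g &
     forall k, k != i -> c (gen k) = gen k].
  case: b; first by exists a.
  exists (a^-1)%g; split; first exact: GV.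
    apply: (can_inj (autK a)); rewrite autVKg !autM.
    by rewrite (aut_lelt a j false) ak // ai conj2_cancel.
  by move=> k ki; rewrite -{1}(ak k ki) autKg.
exists c; split=> //; split=> v; case: (v =P i) => [->|/eqP vi].
- rewrite ci /sym !invgensM (sym_lelt (j, b)) sym_gen.
  by rewrite !invgM mulgA.
- by rewrite ck //; exact: sym_gen.
- by move=> w; rewrite ci !odd_occ_mul addbAC addbb occ_gen; case: (i == w).
- by move=> w; rewrite ck // occ_gen; case: (v == w).
Qed.

Fixpoint lexlt (rs : seq V) (f g : V -> nat) :=
  if rs is r :: rs' then (f r < g r) || ((f r == g r) && lexlt rs' f g) else false.

Lemma lexlt_wf (T : Type) (mu : T -> V -> nat) rs :
  well_founded (fun b a => lexlt rs (mu b) (mu a)).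
Proof.
elim: rs => [|r rs IH] a; first by split=> b /=.
have [n] := ubnP (mu a r); elim: n a => [a|n IHn a an]; first by rewrite ltn0.
elim: (IH a) an => {}a _ IHa an; split => b /= /orP[hlt|/andP[/eqP E hlt]].
  by apply: IHn; apply: leq_trans hlt _.
by apply: IHa => //; rewrite E.
Qed.

(** Only one coordinate has to decrease if the earlier ones do not increase. *)
Lemma lexlt_le r rs f g : r \in rs -> f r < g r ->
  (forall s, index s rs < index r rs -> f s <= g s) -> lexlt rs f g.
Proof.
move=> + fg; elim: rs => //= x rs IH.
rewrite inE eq_sym; case: (x =P r) => [->|/eqP xr] /= rrs H; first by rewrite fg.
have := H x; rewrite eqxx => /(_ isT); rewrite leq_eqVlt => /orP[/eqP E|->//].
rewrite E eqxx (IH rrs) ?orbT // => s sr; case: (x =P s) => [<-|xs]; first by rewrite E.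
by apply: H; case: (x =P s).
Qed.

Lemma lexlt_add rs (f g c : V -> nat) :
  lexlt rs (fun r => f r + c r) (fun r => g r + c r) = lexlt rs f g.
Proof. by elim: rs => //= r rs ->; rewrite ltn_add2r eqn_add2r. Qed.

Lemma lexlt_ext rs (f f' g g' : V -> nat) : f =1 f' -> g =1 g' ->
  lexlt rs f g = lexlt rs f' g'.
Proof. by move=> ff gg; elim: rs => //= r rs ->; rewrite ff gg. Qed.

Local Notation Nvec g := (fun r => occ r g).

(** No map [P_ij] and no inverse of one shortens the image of [i]. *)
Definition irreducible (a : autom raag) := forall i j b, i != j -> dom i j ->
  ~~ lexlt (enum V) (Nvec (a (lelt (j, b)) * a (gen i) * a (lelt (j, b)))%g)
                    (Nvec (a (gen i))).

Definition weight (a : autom raag) (r : V) := \sum_v occ r (a (gen v)).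

(** Composing with [P_ij] changes the image of [i] only, so the weights compare as
    the letter counts of that image do. *)
Lemma descent : (forall a, pure a -> irreducible a -> Gen a) ->
  forall a, pure a -> Gen a.
Proof.
move=> Hirr; apply: (well_founded_ind (@lexlt_wf _ weight (enum V))) => a IH pa.
case: (pselect (irreducible a)) => [|nirr]; first exact: Hirr.
have [[[i j] b] /= [ij dij hlt]] : exists x : V * V * bool,
   [/\ x.1.1 != x.1.2, dom x.1.1 x.1.2 &
   lexlt (enum V) (Nvec (a (lelt (x.1.2, x.2)) * a (gen x.1.1) * a (lelt (x.1.2, x.2)))%g)
     (Nvec (a (gen x.1.1)))].
  apply: contrapT => nex; apply: nirr => i j b ij dij; apply/negP => hlt.
  by apply: nex; exists (i, j, b).
have [c [Gc pc ci ck]] := P_sign_exists b ij dij.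
have [_ GM GV] := Gen_subgroup.
have -> : a = (a * c * c^-1)%g by rewrite mulgK.
apply: GM; last exact: GV.
apply: IH; last exact: pureM.
have D f : weight f =1 (fun r => occ r (f (gen i)) + \sum_(v | v != i) occ r (f (gen v))).
  by move=> r; rewrite /weight (bigD1 i).
rewrite (lexlt_ext _ (D _) (D _)).
rewrite -(lexlt_ext (f := fun r => occ r ((a * c)%g (gen i)) +
  \sum_(v | v != i) occ r (a (gen v))) _ _ (fun r => erefl)); last first.
  by move=> r; congr (_ + _); apply: eq_bigr => v vi; rewrite autMg ck.
by rewrite lexlt_add autMg ci !autM.
Qed.

Definition signed (a : autom raag) v := exists b, a (gen v) = lelt (v, b).

Lemma signed_Gen a : (forall v, signed a v) -> Gen a.
Proof.
have [G1 GM GV] := Gen_subgroup.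
have [n] := ubnP #|[set v | a (gen v) != gen v]|; elim: n a => // n IH a an sa.
case: (pickP (fun v => a (gen v) != gen v)) => [v nv|H0]; last first.
  suff -> : a = 1%g by [].
  by apply: aut_eq => v; have /negbFE/eqP := H0 v.
have av : a (gen v) = ((gen v)^-1)%g.
  by have [[] E] := sa v; move: nv; rewrite E lelt_gen ?eqxx.
have [c [cv ck]] := inversion_exists v.
have Gc : Gen c by apply: Gen_sub; right; left; exists v.
have acv : (a * c)%g (gen v) = gen v by rewrite autMg cv autV av invgK.
have ack k : k != v -> (a * c)%g (gen k) = a (gen k) by move=> kv; rewrite autMg ck.
have -> : a = (a * c * c^-1)%g by rewrite mulgK.
apply: GM; last exact: GV.
apply: IH => [|k]; last first.
  case: (k =P v) => [->|/eqP kv]; first by exists true; rewrite acv.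
  by have [b kb] := sa k; exists b; rewrite ack.
rewrite -ltnS; apply: leq_trans an; rewrite ltnS; apply: proper_card; apply/properP; split.
  apply/fintype.subsetP => k; rewrite !finset.in_set.
  by case: (k =P v) => [->|/eqP kv]; [rewrite acv eqxx|rewrite ack].
by exists v; rewrite finset.in_set // acv eqxx.
Qed.

(** * Irreducible automorphisms fix every generator up to sign *)

Section Irreducible.
Variable a : autom raag.
Hypotheses (pa : pure a) (ia : irreducible a).

Local Notation p c := (a (gen c)).
Local Notation idx r := (index r (enum V)).

Lemma occ_delta c : (forall r, occ r (p c) = (c == r)) -> signed a c.
Proof.
rewrite /occ; case E: (nf (p c)) => [|x w] H; first by have := H c; rewrite eqxx.
have xc : x.1 = c.
  by have := H x.1; rewrite cnt_cons eqxx; case: eqP => // ->.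
have w0 : w = [::].
  case: w E H => // y w E H; have := H y.1; have := H c.
  rewrite !cnt_cons xc !eqxx; case: (c =P y.1) => [<-|] //.
exists x.2; rewrite -(nfK (p c)) E w0 -xc; by case: (x).
Qed.

Lemma occ_alt b r c : occ r (a (lelt (c, b))) = occ r (p c).
Proof. by rewrite aut_lelt; case: b; rewrite ?occ_inv. Qed.

(** Irreducibility for letters instead of generators, in the form in which it is
    used: the count of [r] does not drop if the earlier counts do not grow. *)
Lemma irreducible_lt x y r : x.1 != y.1 -> dom y.1 x.1 ->
  (forall s, idx s < idx r -> occ s (a (lelt x) * a (lelt y) * a (lelt x))%g <= occ s (a (lelt y))) ->
  occ r (a (lelt y)) <= occ r (a (lelt x) * a (lelt y) * a (lelt x))%g.
Proof.
case: x y => [j b] [i d] /= ji dij.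
pose q := (a (lelt (j, if d then b else ~~ b)) * p i * a (lelt (j, if d then b else ~~ b)))%g.
have -> : (a (lelt (j, b)) * a (lelt (i, d)) * a (lelt (j, b)))%g = if d then q else (q^-1)%g.
  rewrite /q; case: (d); first by rewrite (aut_lelt a i).
  by rewrite -[(j, ~~ b)]/(inv (j, b)) -[(i, false)]/(inv (i, true)) !leltV !autV !invgM !invgK mulgA.
have Nq s : occ s (if d then q else (q^-1)%g) = occ s q by case: (d); rewrite ?occ_inv.
move=> H; rewrite Nq occ_alt leqNgt; apply/negP => hlt.
have := ia (if d then b else ~~ b) _ dij; rewrite eq_sym ji => /(_ isT) /negP; apply.
apply: (lexlt_le (r := r)) => [|//|s sr]; first by rewrite mem_enum.
by have := H s sr; rewrite Nq occ_alt.
Qed.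

Lemma starts_cat_has x u v : has (dep x) u -> starts x (u ++ v) = starts x u.
Proof. by elim: u => //= y u IH; rewrite !starts_cons; case: ifP. Qed.

(** If the letter at the front and the letter at the end were the same occurrence,
    its vertex would occur only once. *)
Lemma strip_ends x w : starts x w -> ends x w -> 1 < cnt x.1 w ->
  exists w', teq w (x :: rcons w' x).
Proof.
move=> /starts_cons_eqv[w1 ww1] /(ends_teq ww1) en.
rewrite (teq_cnt _ ww1) cnt_cons eqxx ltnS => x1; move: en.
rewrite /ends rev_cons -cats1 starts_cat_has.
  move=> /ends_rcons_eqv[w' ww']; exists w'; apply: teq_trans ww1 _.
  exact: teq_cons.
move: x1; rewrite -(cnt_rev x.1) /cnt -has_count; apply: sub_has => y /eqP.
by rewrite /dep => ->; rewrite e_irr.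
Qed.

Lemma signed_lelt u : signed a u -> forall x, x.1 = u -> exists d, a (lelt (u, d)) = lelt x.
Proof.
move=> [b ab] [u' d] /= ->; exists (if d then b else ~~ b).
rewrite aut_lelt; case: d; case: b ab => -> //; rewrite -leltV //.
Qed.

Lemma sym_ends w : teq w (rev w) -> forall x, starts x w -> ends x w.
Proof. by move=> ww x; exact: starts_teq. Qed.

Lemma cnt_gt0 x (w : word) : x \in w -> 0 < cnt x.1 w.
Proof. by move=> xw; rewrite /cnt -has_count; apply/hasP; exists x. Qed.

Lemma cnt_gt0P c (w : word) : 0 < cnt c w -> exists2 x, x \in w & x.1 = c.
Proof. by rewrite /cnt -has_count => /hasP[x xw /eqP]; exists x. Qed.

(** The vertex of [x] has even count in the image of [c], so by symmetry [x] is at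
    both ends, and a sign of [P_ij] with [i = c] and [j = x.1] would strip both. *)
Lemma no_initial c x : dom c x.1 -> c != x.1 -> signed a x.1 ->
  ~~ starts x (nf (p c)).
Proof.
move=> cx ncx sx; apply/negP => st.
have sp : teq (nf (p c)) (rev (nf (p c))) by apply/sym_nf; case: pa.
have ev : ~~ odd (occ x.1 (p c)) by case: pa => _ ->.
have x1 : 0 < occ x.1 (p c) by apply: cnt_gt0; exact: starts_mem.
have [|w' ww'] := strip_ends st (sym_ends sp st).
  by rewrite -/(occ x.1 (p c)); case: (occ _ _) ev x1 => [|[]].
have [d ad] := signed_lelt sx (x := inv x) erefl.
have E : (a (lelt (x.1, d)) * a (lelt (c, true)) * a (lelt (x.1, d)))%g = we w'.
  rewrite ad -[lelt (c, true)]/(gen c) -(nfK (p c)) (we_teq ww') we_cons -cats1 we_cat.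
  by rewrite leltV -/(lelt x) mulKg mulgK.
have C s : occ s (p c) = (x.1 == s).*2 + cnt s w'.
  by rewrite /occ (teq_cnt s ww') cnt_cons -cats1 cnt_cat /cnt /= addn0; lia.
have : occ x.1 (p c) <= occ x.1 (we w').
  rewrite -(occ_alt true) -E; apply: irreducible_lt => //= [|s _]; first by rewrite eq_sym.
  by rewrite E occ_alt C; apply: leq_trans (occ_we_le _ _) _; exact: leq_addl.
by rewrite C eqxx; have := occ_we_le x.1 w'; lia.
Qed.

Variable v : V.
Hypothesis above : forall u, dom v u -> ~~ dom u v -> signed a u.

(** The equivalence class of [v] in the domination preorder. *)
Definition cls := [pred c | dom v c && dom c v].

Lemma cls_v : v \in cls. Proof. by rewrite inE dom_refl. Qed.

Lemma cls_dom c w : c \in cls -> dom v w -> dom c w.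
Proof. by rewrite inE => /andP[_ cv]; exact: dom_trans. Qed.

Lemma supp_up c w : c \in cls -> 0 < occ w (p c) -> dom v w.
Proof. by rewrite inE => /andP[vc _] /(pure_dom pa); exact: dom_trans. Qed.

Lemma initial_cls c x : c \in cls -> starts x (nf (p c)) -> x.1 \in cls.
Proof.
move=> cc st; have vx : dom v x.1.
  by apply: supp_up cc _; apply: cnt_gt0; exact: starts_mem.
rewrite inE vx /=; apply: contraTT st => xv; apply: no_initial.
- exact: cls_dom.
- by apply: contraNneq xv => <-; case/andP: cc.
- exact: above.
Qed.

(** Both [w] and [w'] dominate the class, and [w] is adjacent to [c]. *)
Lemma adj_central c w w' : c \in cls -> e c w -> dom v w' -> w' != w -> e w w'.
Proof.
move=> cc cw vw'; have /domP/(_ w cw)[->|//] := cls_dom cc vw'.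
by rewrite eqxx.
Qed.

(** An occurring letter that commutes with everything in sight can be moved to
    the front. *)
Lemma central_cls c w : c \in cls -> 0 < occ w (p c) ->
  (forall z, dom v z -> z != w -> e w z) -> w \in cls.
Proof.
move=> cc wc H.
have : [seq y <- nf (p c) | y.1 == w] != [::] by rewrite -size_eq0 size_filter -lt0n.
case E: [seq y <- nf (p c) | y.1 == w] => [|y s] // _.
have yw : y.1 = w.
  have : y \in [seq y <- nf (p c) | y.1 == w] by rewrite E inE eqxx.
  by rewrite mem_filter => /andP[/eqP].
rewrite -yw; apply: (initial_cls cc); rewrite /starts.
rewrite (_ : filter (dep y) (nf (p c)) = y :: s) // -E.
apply: eq_in_filter => z /cnt_gt0/(supp_up cc) vz; rewrite /dep yw.
case: (z.1 =P w) => [->|/eqP zw]; first by rewrite e_irr.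
by rewrite H.
Qed.

Section CliqueClass.
Hypothesis clique : forall w w', dom v w -> dom v w' -> w != w' -> e w w'.

Lemma clique_supp c w : c \in cls -> 0 < occ w (p c) -> w \in cls.
Proof.
move=> cc wc; apply: (central_cls cc wc) => z vz zw.
by apply: clique => //; [exact: supp_up wc|rewrite eq_sym].
Qed.

Lemma we_power c (u : word) : {in u, forall x, x.1 = c} ->
  exists k, we u = (gen c ^+ k)%g \/ we u = (gen c ^- k)%g.
Proof.
elim: u => [|[d b] u IH] H; first by exists 0; left.
have [k Hk] : exists k, we u = (gen c ^+ k)%g \/ we u = (gen c ^- k)%g.
  by apply: IH => x xu; apply: H; rewrite inE xu orbT.
have /= -> := H (d, b) (mem_head _ _).
rewrite we_cons lelt_gen; case: b {H}; case: Hk => ->.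
- by exists k.+1; left; rewrite expgS.
- case: k => [|k]; first by exists 1; left; rewrite invg1 mulg1.
  by exists k; right; rewrite expgSr invgM mulVKg.
- case: k => [|k]; first by exists 1; right; rewrite mulg1.
  by exists k; left; rewrite expgS mulKg.
by exists k.+1; right; rewrite expgSr invgM.
Qed.

(** All letters of [g] commute; collect those at [c0].  The image of the rest
    contains no [s]. *)
Lemma clique_count g c0 s :
  (forall c c', 0 < occ c g -> 0 < occ c' g -> c != c' -> e c c') ->
  (forall c, c != c0 -> 0 < occ c g -> occ s (p c) = 0) ->
  occ s (a g) = occ c0 g * occ s (p c0).
Proof.
move=> cl H0; set P := fun x : letter => x.1 == c0.
set f1 := filter P (nf g); set f2 := filter (predC P) (nf g).
have uf : teq (nf g) (f1 ++ f2).
  apply: teq_filter => x y xg yg; rewrite /P => /eqP xc yc.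
  by apply: cl; rewrite ?cnt_gt0 // xc eq_sym.
have E : g = (we f1 * we f2)%g by rewrite -we_cat -(we_teq uf) nfK.
have c2 : occ c0 (we f2) = 0.
  apply/eqP; rewrite -leqn0; apply: leq_trans (occ_we_le _ _) _; rewrite leqNgt.
  apply/negP => /cnt_gt0P[x]; rewrite mem_filter /= /P => /andP[/eqP xc _] /xc; exact.
have a2 : occ s (a (we f2)) = 0.
  have : {in f2, forall x, occ s (p x.1) = 0}.
    by move=> x; rewrite mem_filter => /andP[/= xc xg]; apply: H0 => //; exact: cnt_gt0.
  elim: f2 {uf E c2} => [|[d b] f IH] Hf; first by rewrite we_nil morph1 ?occ1 //; exact: autM.
  rewrite we_cons autM occ0r.
    by rewrite occ_alt; apply: (Hf (d, b)); exact: mem_head.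
  by apply: IH => x xf; apply: Hf; rewrite inE xf orbT.
have [k Hk] : exists k, we f1 = (gen c0 ^+ k)%g \/ we f1 = (gen c0 ^- k)%g.
  by apply: we_power => x; rewrite mem_filter => /andP[/eqP].
have sa := pa.1.
rewrite E autM (occ0r _ a2) (occ0r _ c2).
by case: Hk => ->; rewrite ?autV ?occ_inv (morphX _ (autM a)) !occ_exp ?occ_gen ?eqxx ?muln1 //;
  exact: sym_gen.
Qed.

(** One step of Euclid's algorithm: replacing [p c] by [p c * p r ^+ 2] or
    [p c * p r ^- 2], whichever is better, changes its coordinate [s] from [m] to
    the distance of [m] and [2 * n], where [n] is that of [p r].  Without loss at the earlier
    coordinates this must not be an improvement. *)
Lemma clique_red c r s : c \in cls -> r \in cls -> c != r ->
  (forall t, idx t < idx s -> occ t (p r) = 0) ->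
  occ s (p r) = 0 \/ occ s (p c) <= occ s (p r).
Proof.
move=> cc cr ncr H0.
have sa := pa.1.
have cm : commute (p c) (p r).
  by rewrite /commute -!autM (gen_comm (clique _ _ ncr)) //; [case/andP: cc|case/andP: cr].
have [b Hb] := occ_diff s (sa c) (symX 2 (sa r)) (commuteX 2 cm).
have E : (a (lelt (r, b)) * p c * a (lelt (r, b)) =
          p c * (if b then p r ^+ 2 else p r ^- 2))%g.
  rewrite aut_lelt expg2; case: (b); first by rewrite -cm mulgA.
  by rewrite invgM -(commuteV cm) mulgA.
have := @irreducible_lt (r, b) (c, true) s; rewrite /= eq_sym => /(_ ncr).
have -> : dom c r by apply: cls_dom => //; case/andP: cr.
have N2 t : occ t (if b then p r ^+ 2 else p r ^- 2)%g = 2 * occ t (p r).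
  by case: (b); rewrite ?occ_inv occ_exp.
rewrite E Hb occ_exp // => /(_ isT) H.
have : occ s (p c) <= occ s (p c) - 2 * occ s (p r) + (2 * occ s (p r) - occ s (p c)).
  by apply: H => t ts; rewrite occ0r // N2 H0.
lia.
Qed.

Lemma occ_signed u r : signed a u -> occ r (p u) = (u == r).
Proof. by case=> b ->; rewrite occ_lelt. Qed.

(** The coordinates are treated in the order of the enumeration.  Coordinate [r] is
    odd for [p r] and even for the other images, so that [clique_red], used in
    both directions, kills it for all later vertices.  Then [p r] is the only image
    that can produce the single [r] in [gen r], so its coordinate is [1], and one
    more step kills the coordinate for the earlier vertices. *)
Lemma clique_diag r : r \in cls -> forall c, c \in cls -> occ r (p c) = (c == r).
Proof.
have [n] := ubnP (idx r); elim: n r => // n IH r rn cr.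
have IHr s : s \in cls -> idx s < idx r -> forall c, c \in cls -> occ s (p c) = (c == s).
  by move=> cs sr; apply: IH => //; apply: leq_trans sr _.
have low c t : c \in cls -> (t \in cls -> c != t) -> idx t < idx r -> occ t (p c) = 0.
  move=> cc ct tr; case: (boolP (t \in cls)) => tc.
    by rewrite IHr // (negbTE (ct tc)).
  apply/eqP; rewrite -leqn0 leqNgt; apply: contra tc; exact: clique_supp.
have neq_idx s t : idx s < idx t -> t != s by apply: contraTneq => ->; rewrite ltnn.
have odd_r : odd (occ r (p r)) by rewrite pa.2 eqxx.
have even_c c : c != r -> ~~ odd (occ r (p c)) by rewrite pa.2 => /negbTE->.
have lowr t : idx t < idx r -> occ t (p r) = 0.
  by move=> tr; apply: low => // _; exact: neq_idx.
(* For a later vertex the earlier coordinates of both images vanish. *)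
have later c : c \in cls -> idx r < idx c -> occ r (p c) = 0.
  move=> cc rc; have ncr := neq_idx _ _ rc.
  have lowc t : idx t < idx r -> occ t (p c) = 0.
    by move=> tr; apply: low => // _; apply: neq_idx; apply: ltn_trans rc.
  have ev := even_c _ ncr.
  case: (clique_red cr cc _ lowc) => [|//|h1]; first by rewrite eq_sym.
  case: (clique_red cc cr ncr lowr) => h2; first by rewrite h2 in odd_r.
  have h3 : occ r (p c) = occ r (p r) by lia.
  by rewrite h3 odd_r in ev.
pose g := (a^-1)%g (gen r).
have gup c : 0 < occ c g -> dom v c.
  by move=> /(pure_dom (pure_inv pa)); apply: dom_trans; case/andP: cr.
have gcl c c' : 0 < occ c g -> 0 < occ c' g -> c != c' -> e c c'.
  by move=> /gup vc /gup vc'; exact: clique.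
have ag : a g = gen r by exact: autVKg.
have offcls c s : s \in cls -> c \notin cls -> 0 < occ c g -> occ s (p c) = 0.
  move=> cs cc cg; rewrite occ_signed.
    by case: eqP => // cs'; rewrite cs' cs in cc.
  apply: above; first exact: gup.
  by apply: contra cc => cv; rewrite inE gup.
(* [p s] is the only image in which [s] occurs. *)
have early s : s \in cls -> idx s < idx r -> occ s g = 0.
  move=> cs sr; have nrs := neq_idx _ _ sr.
  have := @clique_count g s s gcl; rewrite ag IHr // eqxx muln1 occ_gen (negbTE nrs).
  move=> <- // c cns cg; case: (boolP (c \in cls)) => cc; last exact: offcls.
  by rewrite IHr // (negbTE cns).
(* By [later] and [early], [r] occurs in [p c] for no other letter [c] of [g]. *)
have one : occ r (p r) = 1.
  have := @clique_count g r r gcl; rewrite ag occ_gen eqxx.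
  have H c : c != r -> 0 < occ c g -> occ r (p c) = 0.
    move=> ncr cg; case: (boolP (c \in cls)) => cc; last exact: offcls.
    case: (ltngtP (idx c) (idx r)) => [hlt|hlt|eq].
    - by rewrite early in cg.
    - exact: later.
    by move: ncr; rewrite -(nth_index c (mem_enum V c)) eq nth_index ?mem_enum ?eqxx.
  by move=> /(_ H); case: (occ r (p r)) => [|[|m]]; case: (occ r g) => [|k] //; lia.
move=> c cc; case: (c =P r) => [->//|/eqP ncr].
have ev := even_c _ ncr.
case: (clique_red cc cr ncr lowr); rewrite one // => le.
by case: (occ r (p c)) ev le => [|[|m]].
Qed.

Lemma signed_clique : signed a v.
Proof.
have H r : occ r (p v) = (v == r).
  case: (boolP (r \in cls)) => cr; first exact/clique_diag/cls_v.
  have -> : (v == r) = false by apply: contraNF cr => /eqP <-; exact: cls_v.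
  apply/eqP; rewrite -leqn0 leqNgt; apply: contra cr; apply: clique_supp.
  exact: cls_v.
exact: occ_delta.
Qed.
End CliqueClass.

Section IndependentClass.
Hypothesis indep : forall c c', c \in cls -> c' \in cls -> ~~ e c c'.

(** What is left of the vertices above [v] after removing the neighbours of [v],
    which commute with all the others. *)
Definition far := [pred y | dom v y && ~~ e v y].

Lemma far_indep c y : c \in cls -> y \in far -> ~~ e c y.
Proof.
move=> cc; rewrite inE => /andP[vy nvy]; apply: contra nvy => cy.
case: (v =P y) => [E|/eqP vny].
  by have := indep cc cls_v; rewrite E cy.
by rewrite e_sym (adj_central cc cy) // dom_refl.
Qed.

Lemma cls_far c : c \in cls -> c \in far.
Proof. by move=> cc; rewrite inE indep ?cls_v // andbT; case/andP: cc. Qed.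

Lemma supp_far c w : c \in cls -> 0 < occ w (p c) -> w \in far.
Proof.
move=> cc wc; rewrite inE (supp_up cc wc) /=; apply/negP => vw.
have /(indep cls_v)/negP := central_cls cc wc (fun z => adj_central cls_v vw (w' := z)).
exact.
Qed.

Local Notation isC x := (x.1 \in cls).
Local Notation isY x := (x.1 \in far).

Lemma dep_cls x y : isC x -> isY y -> dep x y.
Proof. exact: far_indep. Qed.

(** A letter of the class commutes with nothing in sight, so for it [starts] is literal. *)
Lemma starts_dep x w : isC x -> {in w, forall y, isY y} -> starts x w = (ohead w == Some x).
Proof.
by move=> cx; case: w => // y w H; rewrite starts_cons dep_cls // H // mem_head.
Qed.

Lemma red_cons_cls y w : isC y -> {in w, forall z, isY z} -> red w ->
  ohead w != Some (inv y) -> red (y :: w).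
Proof. by move=> cy H redw hw /=; rewrite redw andbT starts_dep. Qed.

Lemma red_rcons_cls y w : isC y -> {in w, forall z, isY z} -> red w ->
  ohead (rev w) != Some (inv y) -> red (rcons w y).
Proof.
move=> cy H redw hw; rewrite -[rcons w y]revK; apply: red_rev.
rewrite rev_rcons; apply: red_cons_cls => //; last exact: red_rev.
by move=> z; rewrite mem_rev; exact: H.
Qed.

(** The letter [y] shields both sides from each other, so that there is no
    cancellation across it. *)
Lemma red_glue u y w : isC y -> {in u, forall z, isY z} ->
  red (rcons u y) -> red (y :: w) -> red (u ++ y :: w).
Proof.
move=> cy H r1 r2; rewrite -cat_rcons; apply/negPn/negP.
move=> /(red_catN r1 (red_catr (u := [:: y]) r2))[x].
rewrite /ends rev_rcons starts_cons; case: ifP => [_ /eqP <- st|dxy /starts_mem].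
  by move: r2; rewrite /= st.
by rewrite mem_rev => /H xY; move: dxy; rewrite dep_sym dep_cls.
Qed.

(** Strip equal letters from both ends until the outermost one occurs only once.
    Its count is odd, so it is on the vertex [c]; as it is initial and final and
    commutes with no other letter, nothing else is left. *)
Lemma halve w c : c \in cls -> {in w, forall y, isY y} -> red w -> teq w (rev w) ->
  (forall r, odd (cnt r w) = (c == r)) ->
  exists u y, teq w (u ++ y :: rev u) /\ y.1 = c.
Proof.
move=> cc; have [n] := ubnP (size w); elim: n w => // n IH [|x w] wn wY redw sw od.
  by have := od c; rewrite eqxx.
have sx : starts x (x :: w) by exact: starts_consx.
have ex := sym_ends sw sx.
case: (ltnP 1 (cnt x.1 (x :: w))) => [c2|c1].
  have [w' ww'] := strip_ends sx ex c2.
  have sz : size w' < n.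
    have := teq_size ww'; rewrite /= size_rcons => -[E].
    by move: wn; rewrite ltnS /= E; exact: ltnW.
  have w'Y : {in w', forall y, isY y}.
    move=> y yw'; apply: wY; rewrite (teq_mem y ww') inE mem_rcons inE yw' !orbT //.
  have rw' : red w'.
    by have /= /andP[_] := red_teq ww' redw; rewrite -cats1 => /red_catl.
  have sw' : teq w' (rev w').
    have : teq (x :: rcons w' x) (rev (x :: rcons w' x)).
      by apply: teq_trans (teq_sym ww') _; apply: teq_trans sw _; exact: teq_rev.
    rewrite rev_cons rev_rcons rcons_cons => /teq_cons_inj.
    by rewrite -!cats1 => /teq_catr.
  have od' r : odd (cnt r w') = (c == r).
    rewrite -od (teq_cnt r ww') cnt_cons -cats1 cnt_cat /cnt /= addn0.
    by rewrite addnCA addnn oddD odd_double addbF.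
  have [u [y [h1 h2]]] := IH w' sz w'Y rw' sw' od'.
  exists (x :: u), y; split=> //; apply: teq_trans ww' _.
  rewrite rev_cons; apply: (@teq_cons x _ (u ++ y :: rcons (rev u) x)).
  have -> : u ++ y :: rcons (rev u) x = (u ++ y :: rev u) ++ [:: x].
    by rewrite -catA /= cats1.
  by rewrite -cats1; apply: teq_cat.
have c1' : cnt x.1 (x :: w) = 1.
  by apply/eqP; rewrite eqn_leq c1 cnt_cons eqxx.
have xc : x.1 = c by have := od x.1; rewrite c1'; case: eqP.
exists [::], x; split=> //=.
suff -> : w = [::] by [].
have w0 : cnt x.1 w = 0 by move: c1'; rewrite cnt_cons eqxx; case: (cnt _ _).
move: ex; rewrite /ends starts_dep ?xc //; last first.
  by move=> z; rewrite mem_rev; exact: wY.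
rewrite rev_cons; have := w0; rewrite -(cnt_rev x.1) -[w in w = [::]]revK.
case: (rev w) => //= z l; rewrite cnt_cons => h /eqP [zx].
by move: h; rewrite zx eqxx.
Qed.

(** A half [h.1] and the middle letter [h.2] of the palindrome representing the
    image of [x]; its first letter belongs to the class by [no_initial]. *)
Definition half_of (x : letter) (h : word * letter) :=
  [/\ red (h.1 ++ h.2 :: rev h.1), a (lelt x) = we (h.1 ++ h.2 :: rev h.1),
      h.2.1 = x.1, {in h.1, forall y, isY y} &
      forall y, ohead (h.1 ++ [:: h.2]) = Some y -> isC y].

Lemma half_exists x : isC x -> exists h, half_of x h.
Proof.
move=> cx; pose w := nf (a (lelt x)).
have Nx s : occ s (a (lelt x)) = occ s (p x.1) by case: (x) => c b; rewrite occ_alt.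
have sx : sym (a (lelt x)) by apply: symaut_sym (sym_lelt _); case: pa.
have wY : {in w, forall y, isY y}.
  by move=> y yw; apply: (supp_far cx); rewrite -Nx; exact: cnt_gt0.
have od r : odd (cnt r w) = (x.1 == r) by rewrite -/(occ r (a (lelt x))) Nx pa.2.
have sw : teq w (rev w) by exact/sym_nf.
have [u [y [h1 h2]]] := halve cx wY (red_nf _) sw od.
have ru : red (u ++ y :: rev u) by apply: red_teq h1 (red_nf _).
exists (u, y); split=> //=.
- by rewrite -(we_teq h1) nfK.
- by move=> z zu; apply: wY; rewrite (teq_mem z h1) mem_cat zu.
(* Initial letters are only known for images of generators; the inverse of a
   symmetric element is obtained by inverting its letters. *)
have Ew : teq (nf (p x.1)) (u ++ y :: rev u) \/ teq (nf (p x.1)) (map inv (u ++ y :: rev u)).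
  case E: x => [c b] /=.
  have : a (gen c) = a (lelt x) \/ a (gen c) = invgens (a (lelt x)).
    rewrite sx E aut_lelt; case: (b); [by left | by right; rewrite invgK].
  case=> ->; first by left.
  right; apply: nf_eq; first exact: red_inv.
  by rewrite -invgens_we -(we_teq h1) nfK.
move=> z hz; case: Ew => Ew.
  apply: (initial_cls cx); apply: (starts_teq (teq_sym Ew)).
  by case: (u) hz => [|z' u'] /= [<-]; exact: starts_consx.
rewrite -[z.1]/((inv z).1); apply: (initial_cls cx); apply: (starts_teq (teq_sym Ew)).
by case: (u) hz => [|z' u'] /= [<-]; exact: starts_consx.
Qed.

(** Let the images of [x1] and [x2] be [u y (rev u)] and [s z (rev s)].  If [s]
    began with the inverse of [y (rev u)], then multiplying the second on both sides by
    the first would remove [y] twice and add nothing.  When [x1] and [x2] lie on the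
    same vertex they are equal, and the lengths of the two images differ. *)
Lemma middle_survives h1 h2 x1 x2 w : isC x1 -> isC x2 -> x2 != inv x1 ->
  half_of x1 h1 -> half_of x2 h2 -> ~ teq h2.1 (map inv h1.1 ++ inv h1.2 :: w).
Proof.
case: h1 h2 => [u y] [s z] c1 c2 n12 [/= r1 a1 m1 Y1 i1] [/= r2 a2 m2 Y2 i2] sE.
have cs r : cnt r s = cnt r u + (y.1 == r) + cnt r w.
  by rewrite (teq_cnt r sE) cnt_cat cnt_cons cnt_map_inv addnA.
have E : (a (lelt x1) * a (lelt x2) * a (lelt x1))%g = we (u ++ w ++ z :: rev w ++ rev u).
  have Es : we s = ((we (rev u))^-1 * ((lelt y)^-1 * we w))%g.
    rewrite (we_teq sE) we_cat we_cons leltV -we_inv.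
    by rewrite /inv_word map_rev revK.
  have Ers : we (rev s) = (we (rev w) * (lelt y)^-1 * (we u)^-1)%g.
    rewrite (we_teq (teq_rev sE)) rev_cat rev_cons -cats1 !we_cat -/(lelt _) leltV -we_inv.
    by [].
  rewrite a1 a2 !we_cat !we_cons !we_cat Es Ers -!mulgA.
  by rewrite !mulVKg !mulKg.
have N1' r : occ r (a (lelt x2)) = (cnt r s).*2 + (z.1 == r).
  by rewrite a2 occ_we // cnt_cat cnt_cons cnt_rev; lia.
have le r : occ r (a (lelt x1) * a (lelt x2) * a (lelt x1))%g + (y.1 == r).*2 <= occ r (a (lelt x2)).
  rewrite N1' E cs; have := occ_we_le r (u ++ w ++ z :: rev w ++ rev u).
  by rewrite !cnt_cat cnt_cons cnt_cat !cnt_rev; lia.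
case: (x1.1 =P x2.1) => [b12|/eqP b12].
  have x12 : x2 = x1 by case: (same_base (esym b12)) => // E'; rewrite E' eqxx in n12.
  have := occ_we y.1 r1; rewrite -a1 -x12 N1' cnt_cat cnt_cons cnt_rev cs eqxx m1 m2 x12 eqxx.
  lia.
have d21 : dom x2.1 x1.1 by apply: cls_dom => //; case/andP: c1.
have := @irreducible_lt x1 x2 y.1 b12 d21.
have := le y.1; rewrite eqxx => l1 H.
have := H (fun s' _ => leq_trans (leq_addr _ _) (le s')); lia.
Qed.

(** The action of [a] on letters outside the class, which it fixes up to sign. *)
Definition flip (x : letter) := if a (lelt x) == lelt x then x else inv x.

Lemma flip_base x : (flip x).1 = x.1. Proof. by rewrite /flip; case: ifP. Qed.

Lemma lelt_inj : injective lelt.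
Proof.
move=> x y /word_eltP xy.
have /(teq_mem x) := red_eqv_teq (u := [:: x]) (v := [:: y]) isT isT xy.
by rewrite !inE eqxx => /esym /eqP.
Qed.

Lemma aut_flip x : isY x -> ~~ isC x -> a (lelt x) = lelt (flip x).
Proof.
rewrite !inE => /andP[vx _]; rewrite vx /= => /(above vx) sx.
rewrite /flip; case: eqP => // ne.
have [d ad] := signed_lelt sx (x := inv x) erefl.
have [E|E] : (x.1, d) = x \/ (x.1, d) = inv x by exact: same_base.
  by rewrite E in ad.
rewrite E in ad; case: ne; apply: invg_inj.
by rewrite -autV -leltV.
Qed.

Lemma we_flip m : {in m, forall x, isY x} -> {in m, forall x, ~~ isC x} ->
  a (we m) = we (map flip m).
Proof.
elim: m => [|x m IH] Hy Hc; first by rewrite we_nil morph1 //; exact: autM.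
rewrite /= !we_cons autM aut_flip ?Hy ?Hc ?mem_head // IH // => y ym.
  by apply: Hy; rewrite inE ym orbT.
by apply: Hc; rewrite inE ym orbT.
Qed.

Lemma red_flip m : {in m, forall x, isY x} -> {in m, forall x, ~~ isC x} ->
  red m -> red (map flip m).
Proof.
elim: m => //= x m IH Hy Hc /andP[sx rm].
rewrite IH ?andbT //; last 2 first.
- by move=> y ym; apply: Hy; rewrite inE ym orbT.
- by move=> y ym; apply: Hc; rewrite inE ym orbT.
apply: contra sx; rewrite /starts filter_map.
rewrite (eq_filter (a2 := dep (inv x))); last first.
  by move=> y /=; rewrite /dep /= !flip_base.
case E: (filter _ m) => [|y l] //= /eqP/Some_inj ty.
have ym : y \in m.
  have : y \in filter (dep (inv x)) m by rewrite E mem_head.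
  by rewrite mem_filter => /andP[].
apply/eqP; congr Some; apply: lelt_inj; apply: (can_inj (autK a)).
rewrite aut_flip; first last.
- by apply: Hc; rewrite inE ym orbT.
- by apply: Hy; rewrite inE ym orbT.
by rewrite ty !leltV autV aut_flip ?Hy ?Hc ?mem_head.
Qed.

Section Surviving.
Variable h : letter -> word * letter.
Hypothesis hP : forall x, isC x -> half_of x (h x).

(** Up to the first class letter [x] of [t], the image of [t] is what one reads off
    letter by letter, including the middle letter of the image of [x]. *)
Definition survives (t : word) :=
  (forall x, x \in t -> ~~ isC x) \/
  exists m x t' z, [/\ t = m ++ x :: t', {in m, forall x, ~~ isC x}, isC x,
    red (map flip m ++ (h x).1 ++ (h x).2 :: z) &
    a (we t) = we (map flip m ++ (h x).1 ++ (h x).2 :: z)].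

(** The image of [x] ends with a class letter, which a letter outside the class
    cannot cancel. *)
Lemma red_join_cls (x : letter) (m R : word) : isC x -> {in m, forall y, ~~ isC y /\ isY y} -> m != [::] ->
  red (map flip m ++ R) -> red ((h x).1 ++ (h x).2 :: rev (h x).1 ++ map flip m ++ R).
Proof.
move=> cx Hm m0 r2; have [r1 _ m1 Y1 i1] := hP cx.
have -> : (h x).1 ++ (h x).2 :: rev (h x).1 ++ map flip m ++ R =
          ((h x).1 ++ (h x).2 :: rev (h x).1) ++ map flip m ++ R by rewrite -catA.
apply/negPn/negP => /(red_catN r1 r2)[y ey sy].
case: m m0 Hm r2 sy => // z m _ Hm r2.
have [ncz yz] := Hm z (mem_head _ _).
have wY : {in (h x).1 ++ (h x).2 :: rev (h x).1, forall y, isY y}.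
  move=> y'; rewrite mem_cat inE mem_rev => /orP[/Y1//|/orP[/eqP->|/Y1//]].
  by apply: cls_far; rewrite m1.
have cy : isC y.
  move: ey; rewrite /ends rev_cat rev_cons revK cat_rcons.
  case E: (h x).1 i1 => [|z' u] /= i1.
    by rewrite starts_cons; case: ifP => // _ /eqP <-; exact: i1.
  have cz' : isC z' by exact: i1.
  rewrite starts_cons; case: ifP => [_ /eqP <- //|].
  move=> dyz /starts_mem yu; move: dyz; rewrite dep_sym dep_cls //.
  by apply: wY; rewrite E cat_cons inE yu orbT.
rewrite map_cons cat_cons starts_cons dep_cls //; last by rewrite flip_base.
by move=> /eqP E; move: ncz; rewrite -(flip_base z) E cy.
Qed.

(** Induction from the right.  The only critical case is that of two consecutive
    class letters [x] and [y]: there the second half of the image of [x] and the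
    first half of that of [y] cancel to [A ++ B], and [middle_survives] says that
    neither middle letter is affected. *)
Lemma survivesP t : {in t, forall x, isY x} -> red t -> survives t.
Proof.
elim: t => [|x t IH] tY rt; first by left.
have [xY tY'] : isY x /\ {in t, forall x, isY x}.
  by split; [apply: tY; exact: mem_head|move=> y yt; apply: tY; rewrite inE yt orbT].
have rt' : red t by case/andP: rt.
case: (boolP (isC x)) => cx; last first.
  case: (IH tY' rt') => [nC|[m [y [t' [z [tE mC cy rz az]]]]]].
    by left=> y; rewrite inE => /orP[/eqP->|/nC].
  right; exists (x :: m), y, t', z.
  have mC' : {in x :: m, forall x, ~~ isC x}.
    by move=> u; rewrite inE => /orP[/eqP->|/mC].
  have mY : {in x :: m, forall x, isY x}.
    by move=> u um; apply: tY; rewrite tE -cat_cons mem_cat um.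
  have rm : red (x :: m).
    by move: rt; rewrite tE -cat_cons; exact: red_catl.
  split=> //; first by rewrite tE.
    have rl := red_flip mY mC' rm; have rr := red_catr rz.
    apply/negPn/negP => /(red_catN rl rr)[u]; rewrite /ends => /starts_mem.
    rewrite mem_rev => /mapP[u0 um ->].
    have [_ _ m1 _ i1] := hP cy.
    have [w0 [s0 [Ew cw0]]] : exists w0 s0, (h y).1 ++ (h y).2 :: z = w0 :: s0 /\ isC w0.
      case E: (h y).1 i1 => [|w0 s0] /= i1; last by exists w0, (s0 ++ (h y).2 :: z); split=> //; exact: i1.
      by exists (h y).2, z; split=> //; exact: i1.
    rewrite Ew starts_cons dep_sym dep_cls //; last by rewrite /= flip_base mY.
    move=> /eqP E; move: cw0; rewrite E /= flip_base; apply/negP; exact: mC'.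
  rewrite we_cons autM az /= !we_cons aut_flip //; exact: mem_head.
have [r1 a1 m1 Y1 i1] := hP cx.
have cyx : isC (h x).2 by rewrite m1.
right; exists [::], x, t.
case: (IH tY' rt') => [nC|[m [y [t' [z [tE mC cy rz az]]]]]].
  exists (rev (h x).1 ++ map flip t); split=> //=.
    case: (t =P [::]) => [->|/eqP t0]; first by rewrite /= cats0.
    rewrite -[map flip t]cats0; apply: red_join_cls => //.
      by move=> u ut; split; [exact: nC|exact: tY'].
    by rewrite cats0; apply: red_flip.
  by rewrite we_cons autM a1 (we_flip tY' nC) -we_cat -catA.
have mY : {in m, forall x, isY x}.
  by move=> u um; apply: tY'; rewrite tE mem_cat um.
have [r2 a2 m2 Y2 i2] := hP cy.
have chy : isC (h y).2 by rewrite m2.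
case: (m =P [::]) => [m0|/eqP m0]; last first.
  exists (rev (h x).1 ++ map flip m ++ (h y).1 ++ (h y).2 :: z); split=> //=.
    apply: red_join_cls => //; by move=> u um; split; [exact: mC|exact: mY].
  by rewrite we_cons autM a1 az -we_cat -catA.
move: tE rz az; rewrite m0 /= => tE rz az.
have nxy : y != inv x.
  by move: rt; rewrite tE /= starts_cons depV dep_cls // => [/andP[]|]; last exact: cls_far.
have nyx : x != inv y by apply: contra nxy => /eqP->; rewrite invK.
set u := (h x).1 in r1 a1 Y1 i1 *; set b := (h x).2 in r1 a1 m1 cyx i1 *.
set s := (h y).1 in rz az r2 a2 Y2 i2 *; set d := (h y).2 in rz az r2 a2 m2 chy i2 *.
have rub : red (rcons u b) by move: r1; rewrite -cat_rcons; exact: red_catl.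
have rbu : red (b :: rev u) by exact: red_catr r1.
have rsd : red (rcons s d) by move: rz; rewrite -cat_rcons; exact: red_catl.
have rdz : red (d :: z) by exact: red_catr rz.
have [A [c [B [h1 h2 h3]]]] := cancel_cat (red_catr (u := [:: b]) rbu) (red_catl rz).
have AY : {in A, forall y, isY y}.
  by move=> w wA; apply: Y1; rewrite -mem_rev (teq_mem w h1) mem_cat wA.
have BY : {in B, forall y, isY y}.
  by move=> w wB; apply: Y2; rewrite (teq_mem w h2) mem_cat wB orbT.
have ABY : {in A ++ B, forall y, isY y}.
  by move=> w; rewrite mem_cat => /orP[/AY|/BY].
have rbA : red (b :: A).
  have := red_teq (teq_cons b h1) rbu; rewrite -cat_cons; exact: red_catl.
have rBd : red (rcons B d).
  have : teq (rcons s d) (inv_word c ++ rcons B d).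
    by rewrite -cats1 -rcons_cat -cats1; apply: teq_cat.
  by move=> /red_teq /(_ rsd) /red_catr.
have revinv w : rev (inv_word w) = map inv w by rewrite /inv_word revK.
(* If the second half of the image of [x] cancels completely, the middle letter
   of [x] meets [B]. *)
have hd : ohead (A ++ B) != Some (inv b).
  case: A h1 h3 AY ABY rbA => [|f A] h1 h3 AY ABY rbA /=; last first.
    by move: rbA => /= /andP[]; rewrite starts_cons depV dep_cls // AY // mem_head.
  case: B h2 h3 BY ABY rBd => [|f B] h2 h3 BY ABY rBd //=; apply/eqP => -[fb].
  apply: (middle_survives cx cy nxy (hP cx) (hP cy) (w := B)).
  rewrite -/s -/u -/b -fb; apply: teq_trans h2 _; apply: teq_cat => //.
  have := teq_inv (teq_rev h1); rewrite revK /= => H.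
  by apply: teq_sym; rewrite /inv_word -map_rev.
(* The mirror image of the previous case. *)
have tl : ohead (rev (A ++ B)) != Some (inv d).
  rewrite rev_cat.
  have rdB : red (d :: rev B) by rewrite -rev_rcons; exact: red_rev.
  case EB: (rev B) rdB => [|f B'] rdB /=; last first.
    move: rdB => /= /andP[]; rewrite starts_cons depV dep_cls //.
    by apply: BY; rewrite -mem_rev EB mem_head.
  have B0 : B = [::] by rewrite -[B]revK EB.
  case EA: (rev A) => [|f A'] //=; apply/eqP => -[fd].
  apply: (middle_survives cy cx nyx (hP cy) (hP cx) (w := A')).
  rewrite -/s -/u -/d -fd -EA.
  have := teq_rev h1; rewrite revK rev_cat => h1'; apply: teq_trans h1' _.
  apply: teq_cat => //; apply: teq_sym; have := teq_inv h2.
  by rewrite B0 cats0 /inv_word map_rev (mapK (@invK)).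
have rABd : red (rcons (A ++ B) d) by exact: red_rcons_cls.
have rbABd : red (b :: rcons (A ++ B) d).
  apply: red_cons_cls => //.
    by move=> w; rewrite mem_rcons inE => /orP[/eqP->|/ABY//]; exact: cls_far.
  case EAB: (A ++ B) hd => [|f l] //= _.
  apply/eqP => -[db].
  have AB0 : A = [::] /\ B = [::] by case: (A) EAB; case: (B).
  have [A0 B0] := AB0.
  (* Both halves cancel completely and the middle letters are inverse to each
   other, so the two images are, too. *)
  have P1 : (a (lelt x) * a (lelt y))%g = 1%g.
    have E1 : we (rev u) = we c by rewrite (we_teq h1) A0.
    have E2 : we s = ((we c)^-1)%g by rewrite (we_teq h2) B0 cats0 we_inv.
    have E3 : we (rev s) = ((we u)^-1)%g.
      rewrite (we_teq (teq_rev h2)) B0 cats0 revinv -[u]revK.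
      have := teq_rev h1; rewrite A0 /= => /we_teq ->.
      by rewrite -we_inv /inv_word map_rev revK.
    rewrite a1 a2 !we_cat !we_cons E1 E2 E3 db leltV -!mulgA.
    by rewrite (mulVKg (we c)) mulVKg mulgV.
  have : (lelt x * lelt y)%g = 1%g.
    by apply: (can_inj (autK a)); rewrite autM P1 morph1 //; exact: autM.
  move=> /mulg1_eq; rewrite -leltV => /lelt_inj E; by rewrite E eqxx in nxy.
have rfull : red (u ++ b :: A ++ B ++ d :: z).
  apply: red_glue => //.
  have -> : b :: A ++ B ++ d :: z = (b :: A ++ B) ++ d :: z by rewrite /= catA.
  apply: red_glue => //.
  by move=> w; rewrite inE => /orP[/eqP->|/ABY//]; exact: cls_far.
exists (A ++ B ++ d :: z); split=> //.
rewrite we_cons autM a1 az !we_cat !we_cons !we_cat (we_teq h1) (we_teq h2).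
by rewrite !we_cat we_inv we_cons -!mulgA (mulVKg (we c)).
Qed.

(** Apply [survivesP] to a word [g0] for [a^-1 v], after moving the letters adjacent
    to [v] to its end.  Class letters occur in the image once in total, and the
    middle letter accounts for that one; hence the first half, which would start
    with a class letter, is empty. *)
Lemma signed_of_halves : signed a v.
Proof.
pose g := (a^-1)%g (gen v).
have gup x : x \in nf g -> dom v x.1.
  by move=> /cnt_gt0; exact: (pure_dom (pure_inv pa)).
pose P (x : letter) := isY x.
have uf : teq (nf g) (filter P (nf g) ++ filter (predC P) (nf g)).
  apply: teq_filter => x y /gup vx /gup vy xY; rewrite /P inE vy /= negbK => vay.
  rewrite e_sym; apply: (adj_central cls_v vay vx).
  by apply: contraTneq xY => xy; rewrite /P xy inE vay andbF.
set g0 := filter P _ in uf; set k := filter (predC P) _ in uf.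
have rg0 : red g0 := red_catl (red_teq uf (red_nf g)).
have Nk c : c \in cls -> occ c (a (we k)) = 0.
  move=> cc; have kP x : x \in k -> occ c (a (lelt x)) = 0.
    rewrite mem_filter => /andP[/= nY /gup vx].
    have vax : e v x.1 by move: nY; rewrite /P inE vx negbK.
    have nc : x.1 \notin cls by apply: contraTN vax; exact: indep cls_v.
    have [|d] := above vx; first by move: nc; rewrite inE vx.
    case: x {nY} vx vax nc => x b vx vax nc E; rewrite occ_alt E occ_lelt.
    by apply/eqP; rewrite eqb0; apply: contraNneq nc => /= ->.
  elim: k kP {uf} => [|x k IH] kP; first by rewrite we_nil morph1 ?occ1 //; exact: autM.
  rewrite we_cons autM occ0l ?kP ?mem_head // IH // => y yk; apply: kP.
  by rewrite inE yk orbT.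
have Ng0 c : c \in cls -> occ c (a (we g0)) = (v == c).
  move=> cc; rewrite -(occ0r _ (Nk c cc)) -autM -we_cat -(we_teq uf) nfK.
  by rewrite autVKg occ_gen.
have v0 : 0 < cnt v g0.
  have : odd (occ v (a g)) by rewrite autVKg occ_gen eqxx.
  rewrite (pure_odd _ _ pa) => /odd_gt0 /cnt_gt0P[x xg xv].
  rewrite -xv; apply: cnt_gt0; rewrite mem_filter xg andbT /P xv.
  exact/cls_far/cls_v.
have [x0 x0g x0v] := cnt_gt0P v0.
have g0Y : {in g0, forall x, isY x} by move=> x; rewrite mem_filter => /andP[].
case: (survivesP g0Y rg0) => [/(_ x0 x0g)|[m [x [t' [z [_ _ cx rW aW]]]]]].
  by rewrite x0v cls_v.
have [r1 a1 m1 Y1 i1] := hP cx.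
have cW c : c \in cls -> cnt c (map flip m ++ (h x).1 ++ (h x).2 :: z) = (v == c).
  by move=> cc; rewrite -(occ_we c rW) -aW Ng0.
have xv : x.1 = v.
  have := cW _ cx; rewrite !cnt_cat cnt_cons m1 eqxx; case: eqP => // _; lia.
have u0 : (h x).1 = [::].
  case E: (h x).1 i1 => [|y u] // /(_ y erefl) cy; exfalso.
  have := cW _ cx; have := cW _ cy; rewrite E /= !cnt_cat !cnt_cons !cnt_cat !cnt_cons eqxx m1 xv eqxx.
  case: (v =P y.1) => [->|_]; last by lia.
  by rewrite eqxx; lia.
exists (if x.2 then (h x).2.2 else ~~ (h x).2.2).
have E : a (lelt x) = lelt (h x).2 by rewrite a1 u0.
have Ey : (h x).2 = (v, (h x).2.2) by rewrite -xv -m1; case: (h x).2.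
case: x xv E Ey {cx rW aW r1 a1 m1 Y1 i1 cW u0} => x [] /= <-; first by move=> E <-; rewrite -E.
move=> E Ey; rewrite -[(x, ~~ _)]/(inv (x, _)) -Ey leltV -E.
by rewrite -[(x, false)]/(inv (x, true)) leltV autV invgK.
Qed.
End Surviving.

Lemma signed_indep : signed a v.
Proof.
have [h hP] : {h : letter -> word * letter & forall x, isC x -> half_of x (h x)}.
  apply: (@choice _ _ (fun x h => isC x -> half_of x h)) => x.
  case: (boolP (isC x)) => cx; last by exists ([::], x).
  by have [hx hxP] := half_exists cx; exists hx.
exact: (signed_of_halves hP).
Qed.
End IndependentClass.
End Irreducible.

(** Induction on the number of vertices dominating [v].  If two members of the class
    are adjacent, [adj_central] spreads adjacency to everything above. *)
Lemma irreducible_signed a : pure a -> irreducible a -> forall v, signed a v.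
Proof.
move=> pa ia v; have [n] := ubnP #|[pred u | dom v u]|.
elim: n v => // n IH v vn.
have above u : dom v u -> ~~ dom u v -> signed a u.
  move=> vu nuv; apply: IH; rewrite -ltnS; apply: leq_trans vn; rewrite ltnS.
  apply: proper_card; apply/properP; split.
    by apply/fintype.subsetP => w; rewrite !inE; exact: dom_trans.
  by exists v; rewrite !inE ?dom_refl.
case: (pselect (exists c c', [/\ c \in cls v, c' \in cls v & e c c'])) => [|nex].
  move=> [c [c' [cc cc' ecc]]]; apply: (signed_clique pa ia above) => w w' vw vw' ww'.
  have K z : dom v z -> z != c' -> e c' z by move=> vz zc; exact: (adj_central cc ecc vz zc).
  case: (w =P c') => [wc|/eqP wc]; first by rewrite wc K // -wc eq_sym.
  case: (w' =P c') => [wc'|/eqP wc']; first by rewrite wc' e_sym K.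
  by apply: (adj_central cc' (K w vw wc) vw'); rewrite eq_sym.
apply: (signed_indep pa ia above) => c c' cc cc'; apply/negP => ecc.
by apply: nex; exists c, c'.
Qed.

Lemma pure_Gen a : pure a -> Gen a.
Proof.
by move: a; apply: descent => a pa ia; apply: signed_Gen; exact: irreducible_signed.
Qed.

(** * From palindromic to pure automorphisms *)

(** Only the middle letter, if there is one, has odd count. *)
Lemma palindrome_parity (w : word) : rev w = w ->
  exists o, forall r, odd (cnt r w) = (o == Some r).
Proof.
have [n] := ubnP (size w); elim: n w => // n IH [|x w] wn; first by exists None.
case/lastP: w wn => [|w y] wn; first by exists (Some x.1) => r; rewrite /cnt /= addn0 oddb.
rewrite rev_cons rev_rcons /= => -[-> /rcons_inj[sw]].
have [|o Ho] := IH w _ sw; first by move: wn; rewrite /= size_rcons; lia.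
exists o => r; rewrite -Ho cnt_cons -cats1 cnt_cat /cnt /= addn0 !oddD oddb.
by rewrite addbC addbK.
Qed.

Lemma odd_occ_we r u : odd (occ r (we u)) = odd (cnt r u).
Proof.
elim: u => [|x u IH]; first by rewrite we_nil occ1.
by rewrite we_cons odd_occ_mul IH occ_lelt cnt_cons oddD.
Qed.

(** The inverse of [s] is a power of [s]. *)
Lemma graph_aut_of_hom (s : {perm V}) :
  (forall v w, e v w -> e (s v) (s w)) -> graph_aut e s.
Proof.
move=> H v w; apply/idP/idP => [|/H //].
have HX n v' w' : e v' w' -> e ((s ^+ n)%g v') ((s ^+ n)%g w').
  elim: n v' w' => [|n IH] v' w' vw; first by rewrite expg0 !perm1.
  by rewrite expgS !permM; apply/IH/H.
by move=> /(HX (fingroup.order s).-1); rewrite -fingroup.invg_expg !permK.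
Qed.

Lemma palindromic_symaut (a : autom raag) : palindromic a -> symaut a.
Proof. by move=> pa v; have [w [revw ->]] := pa v; apply/sym_we; rewrite revw; exact: WRefl. Qed.

(** Modulo squares the image of each generator is a generator or trivial, by
    [palindrome_parity]; surjectivity leaves a permutation, whose inverse is [t]. *)
Lemma palindromic_Gen (a : autom raag) : palindromic a -> Gen a.
Proof.
move=> pal; have sa := palindromic_symaut pal.
have [o Ho] : {o : V -> option V & forall v r, odd (occ r (a (gen v))) = (o v == Some r)}.
  apply: (@choice _ _ (fun v x => forall r, odd (occ r (a (gen v))) = (x == Some r))) => v.
  have [w [/palindrome_parity[x Hx] ->]] := pal v; exists x => r.
  by rewrite odd_occ_we Hx.
have surj w : exists v, o v == Some w.
  apply: contrapT => nex.
  have H0 v : odd (occ w (a (gen v))) = pred0 v.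
    by rewrite Ho; apply/negbTE/negP => ov; apply: nex; exists v.
  have := odd_occ_aut H0 ((a^-1)%g (gen w)); rewrite autVKg occ_gen eqxx.
  by rewrite (eq_count (a2 := pred0)) // count_pred0.
have [t Ht] := choice surj.
have tI : injective t.
  by move=> v w E; apply/Some_inj; rewrite -(eqP (Ht v)) -(eqP (Ht w)) E.
pose s := ((perm tI)^-1)%g.
have os v : o v = Some (s v).
  by rewrite -{1}[v](permKV (perm tI)) permE; exact/eqP/Ht.
have gs : graph_aut e s.
  apply: graph_aut_of_hom => v w vw; apply: (odd_class_edge sa _ vw) => [|r|r].
  - by rewrite (inj_eq perm_inj); apply: contraTneq vw => ->; rewrite e_irr.
  - by rewrite Ho os.
  by rewrite Ho os.
have [d dd ds] := diagram_exists gs.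
have [G1 GM GV] := Gen_subgroup.
have Gd : Gen d by apply: Gen_sub; left.
have -> : a = (a * d^-1 * d)%g by rewrite mulgVK.
apply: GM => //; apply: pure_Gen.
have E v : (a * d^-1)%g (gen v) = a (gen ((s^-1)%g v)).
  by rewrite autMg -{1}[v](permKV s) -ds autKg.
by split=> [v|v w]; rewrite E ?Ho ?os ?permKV.
Qed.

(** Substituting palindromes for the letters of a palindrome gives a palindrome. *)
Lemma palindromicM (a b : autom raag) : palindromic a -> palindromic b ->
  palindromic (a * b)%g.
Proof.
move=> pa pb v; have [w [revw bw]] := pb v; rewrite autMg bw.
have [W HW] : {W : letter -> word & forall x, rev (W x) = W x /\ a (lelt x) = we (W x)}.
  apply: (@choice _ _ (fun x w' => rev w' = w' /\ a (lelt x) = we w')) => -[c d].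
  have [u [ru au]] := pa c; rewrite aut_lelt; case: d; first by exists u.
  exists (inv_word u); split; last by rewrite we_inv au.
  by rewrite /inv_word revK -map_rev ru.
exists (flatten (map W w)); split.
  rewrite rev_flatten -map_comp -map_rev revw; congr flatten.
  by apply: eq_map => x /=; case: (HW x).
elim: (w) => [|x u IH] /=; first by rewrite we_nil morph1 //; exact: autM.
by rewrite we_cons autM IH we_cat; case: (HW x) => _ ->.
Qed.

Lemma palindromic1 : palindromic (1%g : autom raag).
Proof. by move=> v; exists [:: (v, true)]. Qed.

Lemma gens_palindromic (a : autom raag) : palindromic_gens e a ->
  palindromic a /\ palindromic (a^-1)%g.
Proof.
have aV b g g' : a g' = g -> b = g' -> (a^-1)%g g = b by move=> <- ->; exact: autKg.
case=> [[s [gs as_]]|[[j [aj ak]]|[i [j [ij [ai ak]]]]]]; split=> v.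
- by exists [:: (s v, true)].
- exists [:: ((s^-1)%g v, true)]; split=> //; apply: aV (erefl _).
  by rewrite as_ permKV.
- case: (v =P j) => [->|/eqP vj]; last by exists [:: (v, true)]; rewrite ak.
  by exists [:: (j, false)]; split=> //; rewrite aj -(lelt_gen j false).
- case: (v =P j) => [->|/eqP vj]; last first.
    by exists [:: (v, true)]; split=> //; apply: aV (erefl _); exact: ak.
  exists [:: (j, false)]; split=> //; apply: aV (erefl _).
  by rewrite -/(lelt _) aut_lelt aj invgK.
- case: (v =P i) => [->|/eqP vi]; last by exists [:: (v, true)]; rewrite ak.
  by exists [:: (j, true); (i, true); (j, true)]; split=> //; rewrite ai !we_cons we_nil mulg1 mulgA.
case: (v =P i) => [->|/eqP vi]; last first.
  by exists [:: (v, true)]; split=> //; apply: aV (erefl _); exact: ak.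
exists [:: (j, false); (i, true); (j, false)]; split=> //; apply: aV (erefl _).
rewrite !we_cons we_nil mulg1 !autM (aut_lelt _ j) (aut_lelt _ i) ai ak ?conj2_cancel //.
  by rewrite mulgA conj2_cancel.
by rewrite eq_sym.
Qed.

Lemma Gen_palindromic (a : autom raag) : Gen a -> palindromic a.
Proof.
(* The condition on the inverse makes closure under inversion immediate. *)
pose K : set (autom raag) := [set b : autom raag | palindromic b /\ palindromic (b^-1)%g]%classic.
have KP : subgroup K.
  split=> [|x y [px px'] [py py']|x [px px']]; split.
  - exact: palindromic1.
  - by rewrite invg1; exact: palindromic1.
  - exact: palindromicM.
  - by rewrite invgM; exact: palindromicM.
  - exact: px'.
  by rewrite invgK.
by move=> Ga; have [] := Ga K (conj KP gens_palindromic).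
Qed.

Lemma finite_subsingleton (T : Type) (A : set T) :
  (forall x y, A x -> A y -> x = y) -> finite_set A.
Proof.
move=> H; case: (pselect (exists x, A x)) => [[x Ax]|nA].
  by apply: (@sub_finite_set _ _ [set x]%classic) => [y Ay|]; [exact: H|exact: finite_set1].
by rewrite (_ : A = set0); [exact: finite_set0|rewrite -subset0 => x Ax; apply: nA; exists x].
Qed.

Lemma finite_gens : finite_set (palindromic_gens e).
Proof.
pose D (s : {perm V}) := [set a : autom raag | forall v, a (gen v) = gen (s v)]%classic.
pose I (j : V) := [set a : autom raag | is_inversion j a]%classic.
pose PP (ij : V * V) := [set a : autom raag | is_P ij.1 ij.2 a]%classic.
have fin (T : finType) (F : T -> set (autom raag)) :
    (forall i a b, F i a -> F i b -> a = b) -> finite_set (\bigcup_i F i)%classic.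
  move=> H; apply: bigcup_finite; first exact: finite_finset.
  by move=> i _; apply: finite_subsingleton; exact: H.
apply: (@sub_finite_set _ _ (\bigcup_s D s `|` (\bigcup_j I j `|` \bigcup_ij PP ij))%classic).
  move=> a [[s [_ as_]]|[[j aj]|[i [j [_ aij]]]]].
  - by left; exists s.
  - by right; left; exists j.
  by right; right; exists (i, j).
rewrite !finite_setU; split; [|split]; apply: fin.
- by move=> s a b sa sb; apply: aut_eq => v; rewrite sa sb.
- move=> j a b [aj ak] [bj bk]; apply: aut_eq => v.
  by case: (v =P j) => [->|/eqP vj]; rewrite ?aj ?bj // ak // bk.
move=> [i j] a b [ai ak] [bi bk]; apply: aut_eq => v.
by case: (v =P i) => [->|/eqP vi]; rewrite ?ai ?bi // ak // bk.
Qed.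

End RaagTheory.

Theorem theorem1 (V : finType) (e : rel V)
    (e_sym : symmetric e) (e_irr : irreflexive e) :
  finite_set (palindromic_gens e) /\
  palindromic_auts e = generated_subgroup (palindromic_gens e).
Proof.
split; first exact: finite_gens.
by apply/seteqP; split=> a; [exact: palindromic_Gen|exact: Gen_palindromic].
Qed.
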